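(* Let $(u,v)$, with $u\ge0$ and $v\ge0$, be a viscosity solution of $$ \left\{ \begin{array}{rcll} \Delta_\infty u & \leq & 1 & \mbox{ in } B_1\\ \Delta v & \leq & 1 & \mbox{ in } B_1\\ \Delta_\infty u & = & 1 & \mbox{ in } B_1 \cap \{v>0\} \\ \Delta v & = & 1 & \mbox{ in } B_1\cap \{u>0\}. \end{array} \right. $$ Then singular points exhaust the set $\partial\{v>0\}\setminus\partial\{u>0\}$, i.e. every point of $\partial\{v>0\}\setminus\partial\{u>0\}$ is a singular point.
   Context: $B_1$ is the open unit ball of $\mathbb{R}^n$ centered at the origin. $\Delta w=\mathrm{trace}(D^2w)$ and $\Delta_\infty w=\langle D^2w\, Dw,Dw\rangle$. Viscosity sense: for an open set $\mathcal{O}$, an operator $H\in\{\Delta,\Delta_\infty\}$ and a function $h$, a function $w\in C(\mathcal{O})$ satisfies $Hw\le h$ (respectively $Hw\ge h$) in $\mathcal{O}$ in the viscosity sense if, whenever $\phi\in C^2(\mathcal{O})$ touches $w$ from below (respectively from above) at $x_0\in\mathcal{O}$, one has $H\phi(x_0)\le h(x_0)$ (respectively $H\phi(x_0)\ge h(x_0)$). The equation $Hw=h$ means that both inequalities hold in the viscosity sense. A pair $(u,v)$ of continuous functions is a viscosity solution of the system if each line holds in the viscosity sense in the indicated open set. Boundaries of subsets of $B_1$ are taken relative to $B_1$. Definition. A free boundary point $x_0\in\partial\{v>0\}$ is called regular if, up to a subsequence, as $r\to0^+$, $$\frac{v(x_0+rx)}{r^2}\to\frac12[(e\cdot x)_+]^2$$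 for some unit vector $e\in\mathbb{S}^{n-1}$. It is called singular if, up to a subsequence, as $r\to0^+$, $$\frac{v(x_0+rx)}{r^2}\to\frac12\langle Ax,x\rangle$$ for some non-negative definite matrix $A\in\mathbb{R}^{n\times n}$ with $\mathrm{tr}(A)=1$. *)

(* Defs.v *)
From HB Require Import structures.
From mathcomp Require Import all_boot all_order all_algebra.
From mathcomp Require Import all_classical all_reals all_analysis.

Set Implicit Arguments.
Unset Strict Implicit.
Unset Printing Implicit Defensive.

Import Order.TTheory GRing.Theory Num.Theory.
Import numFieldNormedType.Exports.

Local Open Scope classical_set_scope.
Local Open Scope ring_scope.

Section Defs.
Variables (R : realType) (n : nat).
Notation E := 'rV[R]_n.

Definition dot (x y : E) : R := \sum_(i < n) x 0 i * y 0 i.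

(* The library norm on 'rV_n is the max norm, so the Euclidean ball is
   written out.  Both norms induce the same topology. *)
Definition unit_ball : set E := [set x | Num.sqrt (dot x x) < 1].

Definition basis (i : 'I_n) : E := delta_mx 0 i.

Definition grad (phi : E -> R) (x : E) : E := \row_i 'D_(basis i) phi x.

Definition hess (phi : E -> R) (x : E) : 'M[R]_n :=
  \matrix_(i, j) 'D_(basis j) ('D_(basis i) phi) x.

(* The column A x, transposed. *)
Definition mxapp (A : 'M[R]_n) (x : E) : E := (A *m x^T)^T.

Definition laplacian (phi : E -> R) (x : E) : R := \tr (hess phi x).

Definition inf_laplacian (phi : E -> R) (x : E) : R :=
  dot (mxapp (hess phi x) (grad phi x)) (grad phi x).

(* phi is C^2 on the open set O; the values of phi outside O are irrelevant. *)
Definition C2 (O : set E) (phi : E -> R) : Prop :=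
  {within O, continuous phi} /\
  forall i,
    [/\ forall x, O x -> derivable phi x (basis i),
        {within O, continuous ('D_(basis i) phi)} &
        forall j,
          (forall x, O x -> derivable ('D_(basis i) phi) x (basis j)) /\
          {within O, continuous ('D_(basis j) ('D_(basis i) phi))}].

(* Touching is local: the inequality is only required near x0. *)
Definition touches_below (phi w : E -> R) (x0 : E) : Prop :=
  phi x0 = w x0 /\ \forall x \near x0, phi x <= w x.

Definition touches_above (phi w : E -> R) (x0 : E) : Prop :=
  phi x0 = w x0 /\ \forall x \near x0, w x <= phi x.

Definition visc_le (H : (E -> R) -> E -> R) (O : set E) (h w : E -> R) : Prop :=
  {within O, continuous w} /\
  forall phi x0, C2 O phi -> O x0 -> touches_below phi w x0 ->
    H phi x0 <= h x0.

Definition visc_ge (H : (E -> R) -> E -> R) (O : set E) (h w : E -> R) : Prop :=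
  {within O, continuous w} /\
  forall phi x0, C2 O phi -> O x0 -> touches_above phi w x0 ->
    h x0 <= H phi x0.

Definition visc_eq (H : (E -> R) -> E -> R) (O : set E) (h w : E -> R) : Prop :=
  visc_le H O h w /\ visc_ge H O h w.

Definition pos_set (w : E -> R) : set E := unit_ball `&` [set x | 0 < w x].

Definition visc_solution (u v : E -> R) : Prop :=
  [/\ visc_le inf_laplacian unit_ball (cst 1) u,
      visc_le laplacian unit_ball (cst 1) v,
      visc_eq inf_laplacian (pos_set v) (cst 1) u &
      visc_eq laplacian (pos_set u) (cst 1) v].

(* Boundary of A `<=` unit_ball in the relative topology of unit_ball. *)
Definition rel_boundary (A : set E) : set E :=
  unit_ball `&` (closure A `&` closure (unit_ball `\` A)).

(* Symmetry is part of non-negative definiteness. *)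
Definition nonneg_definite (A : 'M[R]_n) : Prop :=
  A^T = A /\ forall x : E, 0 <= dot (mxapp A x) x.

(* "Up to a subsequence, as r -> 0+" means along some sequence r_k -> 0+; the
   convergence of the rescalings is locally uniform in R^n.  The point
   x0 + r_k x of a fixed compact set of x lies in unit_ball for k large, so the
   values of v outside unit_ball play no role. *)
Definition singular_point (v : E -> R) (x0 : E) : Prop :=
  rel_boundary (pos_set v) x0 /\
  exists (A : 'M[R]_n) (r : nat -> R),
    [/\ nonneg_definite A,
        \tr A = 1,
        r @ \oo --> 0^'+ &
        {family compact,
          (fun k (x : E) => v (x0 + r k *: x) / r k ^+ 2) @ \oo -->
          (fun x : E => 2^-1 * dot (mxapp A x) x)}].

End Defs.

(* Main.v *)
(* Away from the free boundary of [u], a point [x0] of the free boundary of [v] is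
   interior to [{u > 0}]: were [u = 0] near [x0], the test function [0] would
   contradict [inf_laplacian u = 1] on [{v > 0}].  Hence [Delta v = 1] near [x0]
   in the viscosity sense, and it suffices to show that [v] has a second-order
   Taylor expansion at [x0] whose Hessian has trace 1: as [v >= 0 = v x0], its
   linear part vanishes and its quadratic part is nonnegative.

   Regularity is obtained from polynomials only.  Approximate [v] uniformly by
   polynomials [Q]; on a ball, correct [Q] by a polynomial multiple of
   [eta = s - |x - x0|^2] into a polynomial [P] with [Delta P = 1] and [P = Q] on
   the sphere (the map [p |-> Delta (eta p)] is injective by the maximum principle
   and does not raise the degree, so it is onto by linear algebra).  The comparison
   principle makes [P] close to [v] in the whole ball.  Bernstein's gradient
   estimate for harmonic polynomials then bounds the derivatives of differences of
   such [P] at interior points, so that the Taylor expansions pass to the limit. *)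
From HB Require Import structures.
Require Import Defs.
From mathcomp Require Import all_boot all_order all_algebra.
From mathcomp Require Import all_classical all_reals all_analysis.
From mathcomp Require Import ring lra.

Import Order.TTheory GRing.Theory Num.Theory.
Import numFieldNormedType.Exports.

Set Implicit Arguments.
Unset Strict Implicit.
Unset Printing Implicit Defensive.

Local Open Scope classical_set_scope.
Local Open Scope ring_scope.

(** * Polynomial functions *)

(* Locked: unifying an unfolded derivative with [fun x => ?f x + ?g x] would
   diverge. *)
HB.lock Definition dird (R : realType) (n : nat) (v : 'rV[R]_n)
  (f : 'rV[R]_n -> R) : 'rV[R]_n -> R := fun x => 'D_v f x.

Section PolynomialFunctions.
Variables (R : realType) (n : nat).
Notation E := 'rV[R]_n.
Implicit Types (f g : E -> R) (d : nat) (v w : E).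

(** Polynomials are taken as functions, so that derivatives apply to them directly and their
    properties follow by induction on the way they are built. The index is only an upper bound for
    the degree. *)
Inductive polydeg : nat -> (E -> R) -> Prop :=
| polydeg_cst d c : polydeg d (fun=> c)
| polydegD d f g : polydeg d f -> polydeg d g -> polydeg d (fun x => f x + g x)
| polydegX d f i : polydeg d f -> polydeg d.+1 (fun x => x 0 i * f x)
| polydegS d f : polydeg d f -> polydeg d.+1 f.

Definition ispoly f := exists d, polydeg d f.

Lemma polydeg_le d d' f : (d <= d')%N -> polydeg d f -> polydeg d' f.
Proof.
move=> /subnK <- pf; elim: (d' - d)%N => [|k IH] //=.
exact: polydegS.
Qed.

Lemma polydegM d d' f g : polydeg d f -> polydeg d' g ->
  polydeg (d + d') (fun x => f x * g x).
Proof.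
move=> pf pg; elim: pf => {d f} [d c|d f1 f2 _ IH1 _ IH2|d f i _ IH|d f _ IH].
- apply: (@polydeg_le d'); first by rewrite leq_addl.
  elim: pg => {d' g} [d' c'|d' f1 f2 _ IH1 _ IH2|d' f i _ IH|d' f _ IH].
  + exact: polydeg_cst.
  + under eq_fun do rewrite mulrDr; exact: polydegD.
  + under eq_fun do rewrite mulrCA; exact: polydegX.
  + exact: polydegS.
- under eq_fun do rewrite mulrDl; exact: polydegD.
- under eq_fun do rewrite -mulrA; exact: polydegX.
- exact: polydegS.
Qed.

Lemma polydegZ d f c : polydeg d f -> polydeg d (fun x => c * f x).
Proof. by move=> pf; apply: (@polydegM 0) => //; exact: polydeg_cst. Qed.

Lemma ispoly_cst c : ispoly (fun=> c).
Proof. by exists 0%N; exact: polydeg_cst. Qed.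

Lemma ispolyD f g : ispoly f -> ispoly g -> ispoly (fun x => f x + g x).
Proof.
move=> [d pf] [d' pg]; exists (maxn d d').
by apply: polydegD; [apply: polydeg_le pf|apply: polydeg_le pg];
  rewrite leq_max leqnn ?orbT.
Qed.

Lemma ispolyM f g : ispoly f -> ispoly g -> ispoly (fun x => f x * g x).
Proof. by move=> [d pf] [d' pg]; exists (d + d')%N; exact: polydegM. Qed.

Lemma ispolyN f : ispoly f -> ispoly (fun x => - f x).
Proof.
move=> pf; under eq_fun do rewrite -mulN1r.
by apply: ispolyM => //; exact: ispoly_cst.
Qed.

Lemma ispolyB f g : ispoly f -> ispoly g -> ispoly (fun x => f x - g x).
Proof. by move=> pf pg; apply: ispolyD => //; exact: ispolyN. Qed.

Lemma ispoly_coord i : ispoly (fun x => x 0 i).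
Proof.
exists 1%N; have -> : (fun x : E => x 0 i) = (fun x => x 0 i * 1).
  by apply/funext => x; rewrite mulr1.
exact/polydegX/polydeg_cst.
Qed.

Lemma ispoly_sum (I : Type) (r : seq I) (P : pred I) (F : I -> E -> R) :
  (forall i, ispoly (F i)) -> ispoly (fun x => \sum_(i <- r | P i) F i x).
Proof.
move=> pF; elim: r => [|i r IH].
  by under eq_fun do rewrite big_nil; exact: ispoly_cst.
under eq_fun do rewrite big_cons; case: (P i) => //; exact: ispolyD.
Qed.

Lemma polydeg_sum d (I : Type) (r : seq I) (P : pred I) (F : I -> E -> R) :
  (forall i, polydeg d (F i)) ->
  polydeg d (fun x => \sum_(i <- r | P i) F i x).
Proof.
move=> pF; elim: r => [|i r IH].
  by under eq_fun do rewrite big_nil; exact: polydeg_cst.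
under eq_fun do rewrite big_cons; case: (P i) => //; exact: polydegD.
Qed.

Lemma ispoly_differentiable f x : ispoly f -> differentiable f x.
Proof.
move=> [d]; elim=> {d f} [d c|d f g _ df _ dg|d f i _ df|//].
- exact: differentiable_cst.
- exact: differentiableD.
- apply: differentiableM => //; exact: differentiable_coord.
Qed.

Lemma ispoly_derivable f x v : ispoly f -> derivable f x v.
Proof. by move=> pf; apply/diff_derivable/ispoly_differentiable. Qed.

Lemma ispoly_continuous f : ispoly f -> continuous f.
Proof. by move=> pf x; apply/differentiable_continuous/ispoly_differentiable. Qed.

Lemma dirdE v f : 'D_v f = dird v f.
Proof. by apply/funext => x; rewrite dird.unlock. Qed.

Lemma dirdD f g v : ispoly f -> ispoly g ->
  dird v (fun x => f x + g x) = (fun x => dird v f x + dird v g x).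
Proof.
by move=> pf pg; rewrite -!dirdE; apply/funext => x; apply: deriveD; exact: ispoly_derivable.
Qed.

Lemma dirdM f g v : ispoly f -> ispoly g ->
  dird v (fun x => f x * g x) = (fun x => f x * dird v g x + g x * dird v f x).
Proof.
by move=> pf pg; rewrite -!dirdE; apply/funext => x; apply: deriveM; exact: ispoly_derivable.
Qed.

Lemma dird_cst c v : dird v (fun=> c) = (fun=> 0).
Proof. by rewrite -dirdE; apply/funext => x; exact: derive_cst. Qed.

Lemma dird_coord i v : dird v (fun x => x 0 i) = (fun=> v 0 i).
Proof.
rewrite -dirdE; apply/funext => x; rewrite deriveE; last exact: differentiable_coord.
(* The coordinate is packed as a continuous linear map, which is its own differential. *)
pose c (y : E) := y 0 i.
have cl : linear c by move=> a y z; rewrite /c !mxE.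
pose cL := GRing.isLinear.Build _ _ _ _ _ cl.
pose cl' : {linear E -> R} := HB.pack c cL.
have -> : (fun y : E => y 0 i) = cl' by [].
by rewrite diff_lin //; exact: coord_continuous.
Qed.

Lemma dirdX f i v : ispoly f ->
  dird v (fun x => x 0 i * f x) = (fun x => x 0 i * dird v f x + v 0 i * f x).
Proof.
move=> pf; rewrite dirdM //; last exact: ispoly_coord.
by apply/funext => x; rewrite dird_coord [v 0 i * _]mulrC.
Qed.

Lemma dirdZ f c v : ispoly f ->
  dird v (fun x => c * f x) = (fun x => c * dird v f x).
Proof.
move=> pf; rewrite dirdM //; last exact: ispoly_cst.
by rewrite dird_cst; apply/funext => x; rewrite mulr0 addr0.
Qed.

Lemma dirdN f v : ispoly f -> dird v (fun x => - f x) = (fun x => - dird v f x).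
Proof.
by move=> pf; rewrite -!dirdE; apply/funext => x; apply: deriveN; exact: ispoly_derivable.
Qed.

Lemma dirdB f g v : ispoly f -> ispoly g ->
  dird v (fun x => f x - g x) = (fun x => dird v f x - dird v g x).
Proof. by move=> pf pg; rewrite dirdD ?dirdN //; exact: ispolyN. Qed.

Lemma dird_basis f v x : ispoly f ->
  dird v f x = \sum_i v 0 i * dird (Defs.basis R i) f x.
Proof.
move=> pf; have df := ispoly_differentiable x pf.
rewrite -dirdE deriveE // {1}(row_sum_delta v) linear_sum; apply: eq_bigr => i _.
by rewrite linearZ /= -dirdE deriveE.
Qed.

Lemma laplacianE f x :
  laplacian f x = \sum_i dird (Defs.basis R i) (dird (Defs.basis R i) f) x.
Proof.
by rewrite /laplacian /mxtrace; apply: eq_bigr => i _; rewrite mxE -!dirdE.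
Qed.

Lemma laplacian_fun f : laplacian f =
  fun x => \sum_i dird (Defs.basis R i) (dird (Defs.basis R i) f) x.
Proof. by apply/funext => x; rewrite laplacianE. Qed.

Lemma dird_sum (I : Type) (r : seq I) (F : I -> E -> R) v :
  (forall i, ispoly (F i)) ->
  dird v (fun x => \sum_(i <- r) F i x) = (fun x => \sum_(i <- r) dird v (F i) x).
Proof.
move=> pF; elim: r => [|i r IH].
  have nilE (G : I -> E -> R) : (fun x => \sum_(i <- [::]) G i x) = fun=> 0.
    by apply/funext => x; rewrite big_nil.
  by rewrite !nilE dird_cst.
have consE (G : I -> E -> R) : (fun x => \sum_(j <- i :: r) G j x) =
    fun x => G i x + \sum_(j <- r) G j x.
  by apply/funext => x; rewrite big_cons.
by rewrite !consE dirdD ?IH //; exact: ispoly_sum.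
Qed.

(** The second conjunct makes up for [0.-1 = 0]: when [f] is constant, the term [x 0 i * dird v f x]
    of the product rule must be seen to vanish, since its degree bound would otherwise be 1. *)
Lemma polydeg_dird d f v : polydeg d f ->
  polydeg d.-1 (dird v f) /\ (d = 0%N -> dird v f =1 fun=> 0).
Proof.
elim=> {d f} [d c|d f g pf [IHf f0] pg [IHg g0]|d f i pf [IH f0]|d f pf [IH f0]].
- by rewrite dird_cst; split => //; exact: polydeg_cst.
- rewrite dirdD; [|by exists d..]; split; first exact: polydegD.
  by move=> d0 x; rewrite f0 // g0 // addr0.
- rewrite dirdX; last by exists d.
  split => //=; apply: polydegD; last exact: polydegZ.
  case: d => [|d] in pf IH f0 *.
    by under eq_fun do rewrite f0 // mulr0; exact: polydeg_cst.
  exact: polydegX.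
- by split => //=; apply: polydeg_le IH; exact: leq_pred.
Qed.

Lemma ispoly_dird f v : ispoly f -> ispoly (dird v f).
Proof. by move=> [d /(@polydeg_dird _ _ v)[pf _]]; exists d.-1. Qed.

(** Schwarz's theorem by induction on the polynomial: for a product with a coordinate, swapping the
    directions merely exchanges the two first-order terms of [DD]. *)
Lemma dirdC f v w : ispoly f -> dird v (dird w f) = dird w (dird v f).
Proof.
move=> [d]; elim=> {d f} [d c|d f g pf IHf pg IHg|d f i pf IH|//].
- by rewrite !dird_cst.
- have {}pf : ispoly f by exists d.
  have {}pg : ispoly g by exists d.
  by rewrite !dirdD ?IHf ?IHg //; exact: ispoly_dird.
- have {}pf : ispoly f by exists d.
  have pD u := ispoly_dird u pf.
  have pM u : ispoly (fun x => x 0 i * dird u f x).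
    by apply: ispolyM => //; exact: ispoly_coord.
  have pZ (u : E) : ispoly (fun x => u 0 i * f x).
    by apply: ispolyM => //; exact: ispoly_cst.
  have DD u u' : dird u (dird u' (fun x => x 0 i * f x)) =
      fun x => x 0 i * dird u (dird u' f) x + u 0 i * dird u' f x
               + u' 0 i * dird u f x.
    by rewrite dirdX // dirdD // dirdX // dirdZ.
  by rewrite !DD IH; apply/funext => x; rewrite addrAC.
Qed.

Lemma ispoly_C2 (O : set E) f : ispoly f -> C2 O f.
Proof.
have pc g : ispoly g -> {within O, continuous g}.
  by move=> pg; exact/continuous_subspaceT/ispoly_continuous.
move=> pf; split; first exact: pc.
move=> i; have pDi := ispoly_dird (Defs.basis R i) pf.
rewrite dirdE; split => [x _||j]; [exact: ispoly_derivable|exact: pc|].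
rewrite dirdE; split => [x _|]; first exact: ispoly_derivable.
exact/pc/ispoly_dird.
Qed.

Lemma ispoly_laplacian f : ispoly f -> ispoly (laplacian f).
Proof.
move=> pf; rewrite laplacian_fun.
by apply: ispoly_sum => i; exact/ispoly_dird/ispoly_dird.
Qed.

Lemma polydeg_laplacian d f : polydeg d.+2 f -> polydeg d (laplacian f).
Proof.
move=> pf; rewrite laplacian_fun.
apply: polydeg_sum => i.
have [/(@polydeg_dird _ _ (Defs.basis R i))[] //] :=
  polydeg_dird (Defs.basis R i) pf.
Qed.

Lemma laplacianD f g x : ispoly f -> ispoly g ->
  laplacian (fun x => f x + g x) x = laplacian f x + laplacian g x.
Proof.
move=> pf pg; rewrite !laplacianE -big_split; apply: eq_bigr => i _ /=.
by rewrite !dirdD //; exact: ispoly_dird.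
Qed.

Lemma laplacianZ f c x : ispoly f ->
  laplacian (fun x => c * f x) x = c * laplacian f x.
Proof.
move=> pf; rewrite !laplacianE mulr_sumr; apply: eq_bigr => i _ /=.
by rewrite !dirdZ //; exact: ispoly_dird.
Qed.

Lemma laplacian_cst c (x : E) : laplacian (fun=> c) x = 0.
Proof. by rewrite laplacianE big1 // => i _; rewrite !dird_cst. Qed.

Lemma laplacianN f x : ispoly f ->
  laplacian (fun x => - f x) x = - laplacian f x.
Proof.
move=> pf; rewrite !laplacianE -sumrN; apply: eq_bigr => i _ /=.
by rewrite !dirdN //; exact: ispoly_dird.
Qed.

Lemma laplacianB f g x : ispoly f -> ispoly g ->
  laplacian (fun x => f x - g x) x = laplacian f x - laplacian g x.
Proof.
by move=> pf pg; rewrite laplacianD ?laplacianN //; exact: ispolyN.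
Qed.

Lemma laplacian_sum (I : Type) (r : seq I) (F : I -> E -> R) x :
  (forall i, ispoly (F i)) ->
  laplacian (fun x => \sum_(i <- r) F i x) x = \sum_(i <- r) laplacian (F i) x.
Proof.
move=> pF; rewrite laplacianE.
under [RHS]eq_bigr do rewrite laplacianE.
rewrite exchange_big; apply: eq_bigr => i _ /=.
by rewrite !dird_sum // => j; exact: ispoly_dird.
Qed.

Lemma laplacianM f g x : ispoly f -> ispoly g ->
  laplacian (fun x => f x * g x) x = f x * laplacian g x + g x * laplacian f x
    + 2 * \sum_i dird (Defs.basis R i) f x * dird (Defs.basis R i) g x.
Proof.
move=> pf pg; rewrite !laplacianE !mulr_sumr -!big_split; apply: eq_bigr => i _ /=.
have pDf := ispoly_dird (Defs.basis R i) pf.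
have pDg := ispoly_dird (Defs.basis R i) pg.
by rewrite dirdM // dirdD ?dirdM //; [ring | exact: ispolyM..].
Qed.

Lemma laplacian_dird f v x : ispoly f ->
  laplacian (dird v f) x = dird v (laplacian f) x.
Proof.
move=> pf; rewrite (laplacian_fun f) dird_sum; last by move=> i; exact/ispoly_dird/ispoly_dird.
rewrite laplacianE; apply: eq_bigr => i _.
by rewrite (dirdC _ v) // dirdC //; exact: ispoly_dird.
Qed.

End PolynomialFunctions.

(** * Derivatives along lines *)

Section LineCalculus.
Variables (R : realType) (n : nat).
Notation E := 'rV[R]_n.
Implicit Types (f g : E -> R) (x y v : E) (K : R).

Lemma mvt_bound (g dg : R -> R) K :
  (forall t : R, is_derive t 1 g (dg t)) ->
  (forall t, 0 <= t <= 1 -> `|dg t| <= K) ->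
  forall t, 0 <= t <= 1 -> `|g t - g 0| <= K.
Proof.
move=> dgP dgK t /andP[t0 t1].
have cg : {within `[0, t], continuous g}.
  apply: continuous_subspaceT => u.
  by apply/differentiable_continuous/derivable1_diffP; case: (dgP u).
have [c] := MVT_segment t0 (fun u _ => dgP u) cg.
rewrite in_itv /= => /andP[c0 ct] ->; rewrite subr0 normrM.
have K0 := dgK c; rewrite c0 (le_trans ct t1) in K0.
apply: le_trans (K0 isT); rewrite ler_piMr // ger0_norm //.
Qed.

(** Three successive mean value bounds on the unit interval, each after subtracting one more Taylor
    term; this gives [K] where the sharp constant is [K / 6]. *)
Lemma taylor2_bound (g0 g1 g2 g3 : R -> R) K :
  (forall t : R, is_derive t 1 g0 (g1 t)) ->
  (forall t : R, is_derive t 1 g1 (g2 t)) ->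
  (forall t : R, is_derive t 1 g2 (g3 t)) ->
  (forall t, 0 <= t <= 1 -> `|g3 t| <= K) ->
  `|g0 1 - g0 0 - g1 0 - 2^-1 * g2 0| <= K.
Proof.
move=> d0 d1 d2 bK; have b2 := mvt_bound d2 bK.
have b1 t : 0 <= t <= 1 -> `|g1 t - g1 0 - t * g2 0| <= K.
  move=> t01; pose h u := g1 u - u * g2 0.
  have dh (u : R) : is_derive u 1 h (g2 u - g2 0).
    by apply: is_derive_eq; rewrite /GRing.scale /= ; ring.
  by have := mvt_bound dh b2 t01; rewrite /h; congr (`|_| <= _); ring.
pose h u := g0 u - u * g1 0 - 2^-1 * (u * u) * g2 0.
have dh (u : R) : is_derive u 1 h (g1 u - g1 0 - u * g2 0).
  by apply: is_derive_eq; rewrite /GRing.scale /= ; field.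
have := mvt_bound dh b1 (t := 1); rewrite /h lexx ler01 => /(_ isT).
by congr (`|_| <= _); ring.
Qed.

Lemma is_derive_line f x y (t : R) : ispoly f ->
  is_derive t 1 (fun u => f (x + u *: y)) (dird y f (x + t *: y)).
Proof.
move=> pf; have := @ispoly_derivable _ _ f (x + t *: y) y pf.
rewrite -dirdE /derivable => cf.
have E : (fun h : R => h^-1 *: (((fun u => f (x + u *: y)) \o shift t) (h *: 1)
    - f (x + t *: y))) =
  (fun h : R => h^-1 *: ((f \o shift (x + t *: y)) (h *: y) - f (x + t *: y))).
  apply/funext => h; congr (_ *: (f _ - _)) => /=.
  by rewrite scalerDl addrCA /GRing.scale /= mulr1.
by split; rewrite /derivable ?/derive E.
Qed.

Lemma taylor_poly f x y K : ispoly f ->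
  (forall t, 0 <= t <= 1 -> `|dird y (dird y (dird y f)) (x + t *: y)| <= K) ->
  `|f (x + y) - f x - dird y f x - 2^-1 * dird y (dird y f) x| <= K.
Proof.
move=> pf bK; have pD := ispoly_dird; have L := is_derive_line.
have := taylor2_bound (fun t => L _ x y t pf) (fun t => L _ x y t (pD _ _ _ y pf))
  (fun t => L _ x y t (pD _ _ _ y (pD _ _ _ y pf))) bK.
by rewrite !scale1r !scale0r !addr0.
Qed.

Lemma dirdNv v f x : ispoly f -> dird (- v) f x = - dird v f x.
Proof.
move=> pf; rewrite !(dird_basis _ _ pf) -sumrN; apply: eq_bigr => i _.
by rewrite mxE mulNr.
Qed.

Lemma second_derivative_test f x v : ispoly f ->
  (\forall z \near x, f z <= f x) -> dird v (dird v f) x <= 0.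
Proof.
move=> pf fmax; rewrite leNgt; apply/negP.
(* Reversing [v] changes the sign of the first derivative and keeps the second. *)
wlog v0 : v / 0 <= dird v f x.
  move=> W; case: (leP 0 (dird v f x)) => v0; first exact: W.
  move=> vv; apply: (W (- v)); first by rewrite (dirdNv _ _ pf) oppr_ge0 ltW.
  have -> : dird (- v) f = fun x => - dird v f x.
    by apply/funext => z; rewrite dirdNv.
  by rewrite dirdNv ?dirdN ?opprK //; [exact: ispoly_dird|apply/ispolyN/ispoly_dird].
move=> vv; have pD := ispoly_dird.
have lc : (fun t : R => x + t *: v) @ (0 : R) --> x.
  have -> : nbhs x = nbhs (x + (0 : R) *: v) by rewrite scale0r addr0.
  by apply: cvgD; [exact: cvg_cst|apply: cvgZr_tmp; exact: cvg_id].
have pos : \forall z \near x, 0 < dird v (dird v f) z.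
  have cD : dird v (dird v f) @ x --> dird v (dird v f) x.
    exact/ispoly_continuous/pD/pD.
  exact: (cvgr_gt _ cD).
have : \forall t \near (0 : R), f (x + t *: v) <= f x /\
    0 < dird v (dird v f) (x + t *: v).
  apply: (lc [set z | f z <= f x /\ 0 < dird v (dird v f) z]).
  exact: filterI fmax pos.
move=> /nbhs_ballP[d /= d0 dP].
have {}dP (t : R) : 0 <= t < d -> f (x + t *: v) <= f x /\
    0 < dird v (dird v f) (x + t *: v).
  move=> /andP[t0 td]; apply: dP.
  by rewrite /ball /= sub0r normrN ger0_norm.
have mvt g (t : R) : ispoly g -> 0 < t -> exists2 c, 0 < c < t &
    g (x + t *: v) - g x = dird v g (x + c *: v) * t.
  move=> pg t0.
  have cg : {within `[0, t], continuous (fun u => g (x + u *: v))}.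
    apply: continuous_subspaceT => u; apply/differentiable_continuous.
    by apply/derivable1_diffP; case: (is_derive_line x v u pg).
  have [c] := MVT t0 (fun u _ => is_derive_line x v u pg) cg.
  by rewrite in_itv /= scale0r addr0 subr0; exists c.
have d20 : 0 < d / 2 by rewrite divr_gt0.
(* The mean value theorem is applied to [f], then to its derivative on the shorter segment: the
   slope at [c] is positive, so [f] exceeds [f x] at parameter [d / 2]. *)
have [c /andP[c0 cd] Ec] := mvt f _ pf d20.
have [c' /andP[c'0 c'c] Ec'] := mvt (dird v f) _ (pD _ _ _ _ pf) c0.
have d2d : d / 2 < d by lra.
have [le1 _] : f (x + (d / 2) *: v) <= f x /\
    0 < dird v (dird v f) (x + (d / 2) *: v) by apply: dP; rewrite ltW.
have [_ lt2] : f (x + c' *: v) <= f x /\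
    0 < dird v (dird v f) (x + c' *: v) by apply: dP; rewrite ltW //; lra.
have : 0 < dird v f (x + c *: v).
  by have := mulr_gt0 lt2 c0; rewrite -Ec'; lra.
move=> /mulr_gt0 => /(_ _ d20); rewrite -Ec; lra.
Qed.

Lemma laplacian_at_max f x : ispoly f ->
  (\forall z \near x, f z <= f x) -> laplacian f x <= 0.
Proof.
move=> pf fmax; rewrite laplacianE; apply: sumr_le0 => i _.
exact: second_derivative_test.
Qed.

End LineCalculus.

(** * Maximum and comparison principles *)

Section HarmonicPolynomials.
Variables (R : realType) (n : nat).
Notation E := 'rV[R]_n.
Notation "''e_' i" := (Defs.basis R i) (at level 8, i at level 2).
Implicit Types (f g P Q w : E -> R) (x y z v : E) (s c M : R).

Lemma coord_le_mxnorm x i : `|x 0 i| <= `|x|.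
Proof.
rewrite [leRHS]/Num.norm /= mx_normrE.
exact: (le_bigmax _ (fun ij : 'I_1 * 'I_n => `|x ij.1 ij.2|) (0, i)).
Qed.

Lemma mxnorm_le x c : 0 <= c -> (forall i, `|x 0 i| <= c) -> `|x| <= c.
Proof.
move=> c0 xc; rewrite [leLHS]/Num.norm /= mx_normrE.
by apply/bigmax_leP; split => //= -[i j] _ /=; rewrite ord1.
Qed.

(** The square of the Euclidean distance is itself a polynomial, unlike the distance and the max
    norm. *)
Definition sqdist x y : R := Defs.dot (y - x) (y - x).

Lemma sqdistE x y : sqdist x y = \sum_i (y 0 i - x 0 i) ^+ 2.
Proof. by apply: eq_bigr => i _; rewrite !mxE expr2. Qed.

Lemma sqdist_ge0 x y : 0 <= sqdist x y.
Proof. by rewrite sqdistE; apply: sumr_ge0 => i _; exact: sqr_ge0. Qed.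

Lemma sqdistxx x : sqdist x x = 0.
Proof. by rewrite sqdistE big1 // => i _; rewrite subrr expr0n. Qed.

Lemma sqr_coord_le_sqdist x y i : (y 0 i - x 0 i) ^+ 2 <= sqdist x y.
Proof.
rewrite sqdistE (bigD1 i) //= lerDl.
by apply: sumr_ge0 => j _; exact: sqr_ge0.
Qed.

Lemma ispoly_coordB i c : ispoly (fun x => x 0 i - c).
Proof. by apply: ispolyB; [exact: ispoly_coord|exact: ispoly_cst]. Qed.

Lemma dird_coordB i c v : dird v (fun x => x 0 i - c) = fun=> v 0 i.
Proof.
rewrite dirdB ?dird_cst ?dird_coord; [|exact: ispoly_coord|exact: ispoly_cst].
by apply/funext => x; rewrite subr0.
Qed.

Lemma sqdist_fun x : sqdist x = fun y => \sum_i (y 0 i - x 0 i) * (y 0 i - x 0 i).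
Proof. by apply/funext => y; rewrite sqdistE. Qed.

Lemma ispoly_sqdist x : ispoly (sqdist x).
Proof.
rewrite sqdist_fun; apply: ispoly_sum => i.
by apply: ispolyM; exact: ispoly_coordB.
Qed.

Lemma basisE i j : ('e_i : E) 0 j = if j == i then 1 else 0.
Proof. by rewrite /Defs.basis mxE eqxx; case: eqP. Qed.

Lemma dird_sqdist x i : dird 'e_i (sqdist x) = fun y => 2 * (y 0 i - x 0 i).
Proof.
rewrite sqdist_fun dird_sum; last by move=> j; apply: ispolyM; exact: ispoly_coordB.
apply/funext => y; rewrite (bigD1 i) //= big1 => [|j ji].
  by rewrite dirdM ?dird_coordB ?basisE ?eqxx; [ring|exact: ispoly_coordB..].
rewrite dirdM ?dird_coordB ?basisE ?(negbTE ji); [|exact: ispoly_coordB..].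
by rewrite mulr0 addr0.
Qed.

Lemma laplacian_sqdist x y : laplacian (sqdist x) y = 2 * n%:R.
Proof.
rewrite laplacianE (eq_bigr (fun=> 2)) => [|i _].
  by rewrite sumr_const card_ord mulr_natr.
rewrite dird_sqdist dirdZ; last exact: ispoly_coordB.
by rewrite dird_coordB basisE eqxx mulr1.
Qed.

(** The parameter [s] is the square of the radius. *)
Definition cball x s : set E := [set y | sqdist x y <= s].

Lemma nbhs_cball x s y : sqdist x y < s -> \forall z \near y, sqdist x z < s.
Proof.
have cy : sqdist x @ y --> sqdist x y.
  exact/ispoly_continuous/ispoly_sqdist.
exact: (cvgr_lt _ cy).
Qed.

Lemma compact_cball x s : compact (cball x s).
Proof.
apply: bounded_closed_compact.
  (* Here [s + 1] serves as an upper bound for the square root of [s]. *)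
  exists (`|x| + (s + 1)); split; first exact: num_real.
  move=> K sK y xy; apply: (le_trans _ (ltW sK)).
  rewrite -[y](subrK x) addrC; apply: (le_trans (ler_normD _ _)).
  have s0 : 0 <= s := le_trans (sqdist_ge0 x y) xy.
  apply: lerD => //; apply: mxnorm_le => [|i]; first lra.
  have := le_trans (sqr_coord_le_sqdist x y i) xy.
  rewrite !mxE -real_normK ?num_real // => h.
  rewrite leNgt; apply/negP => h'; move: (normr_ge0 (y 0 i - x 0 i)); nra.
apply: (@closed_comp _ _ (sqdist x) [set r | r <= s]); last exact: closed_le.
by move=> y _; exact/ispoly_continuous/ispoly_sqdist.
Qed.

(* If [w - P] exceeded [M] somewhere, then some translate
   [P - delta |x - x0|^2 + const], whose Laplacian is below [c], would touch [w]
   from above at an interior point. *)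
Lemma comparison x0 s w c P M : (0 < n)%N ->
  {within cball x0 s, continuous w} ->
  (forall Q z, ispoly Q -> sqdist x0 z < s -> touches_above Q w z ->
    c <= laplacian Q z) ->
  ispoly P -> (forall z, sqdist x0 z < s -> laplacian P z <= c) ->
  (forall z, sqdist x0 z = s -> w z - P z <= M) ->
  forall z, cball x0 s z -> w z - P z <= M.
Proof.
move=> n0 cw sub pP lP bdP y ys; rewrite leNgt; apply/negP => My.
have s0 : 0 <= s := le_trans (sqdist_ge0 x0 y) ys.
(* The perturbation [dl * sqdist x0] stays below the excess [w y - P y - M] on the ball, so the
   maximum of [w - N] cannot lie on the sphere. *)
pose dl := (w y - P y - M) / (2 * (s + 1)).
have dl0 : 0 < dl by apply: divr_gt0; lra.
have dlE : dl * (2 * (s + 1)) = w y - P y - M.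
  by rewrite /dl divfK // gt_eqF //; lra.
pose N x := P x - dl * sqdist x0 x.
have pS := ispoly_sqdist x0.
have pN : ispoly N by apply: ispolyB => //; apply: ispolyM => //; exact: ispoly_cst.
have cG : {within cball x0 s, continuous (fun x => w x - N x)}.
  move=> x; apply: continuousB; first exact: cw.
  exact/continuous_subspaceT/ispoly_continuous.
have [z /[!inE] zs zmax] := EVT_max_rV (ex_intro _ y ys : cball x0 s !=set0) (@compact_cball x0 s) cG.
have {}zmax x : cball x0 s x -> w x - N x <= w z - N z.
  by move=> xs; apply: zmax; rewrite inE.
move: (zs); rewrite /cball /= le_eqVlt => /orP[/eqP zE|zlt].
  have := zmax _ ys; have := bdP _ zE; rewrite /N zE.
  have := mulr_ge0 (ltW dl0) (sqdist_ge0 x0 y); nra.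
pose Q x := N x + (w z - N z).
have pQ : ispoly Q by apply: ispolyD => //; exact: ispoly_cst.
have : c <= laplacian Q z.
  apply: sub => //; split; first by rewrite /Q addrC subrK.
  near=> x; rewrite /Q -lerBlDl; apply: zmax; rewrite /cball /= ltW //.
  by near: x; exact: nbhs_cball.
rewrite laplacianD //; last exact: ispoly_cst.
rewrite laplacian_cst addr0 laplacianB //; last by apply: ispolyM => //; exact: ispoly_cst.
rewrite laplacianZ // laplacian_sqdist; apply/negP; rewrite -ltNge.
have := lP _ zlt; have n1 : 1 <= n%:R :> R by rewrite ler1n.
nra.
Unshelve. all: by end_near. Qed.

(** Comparison with the zero polynomial: where [Q] touches [f] from above, [f - Q] has a local
    maximum, so [f] satisfies the required viscosity inequality. *)
Lemma max_principle x0 s f M : (0 < n)%N -> ispoly f ->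
  (forall z, sqdist x0 z < s -> 0 <= laplacian f z) ->
  (forall z, sqdist x0 z = s -> f z <= M) ->
  forall z, cball x0 s z -> f z <= M.
Proof.
move=> n0 pf lf bf z zs; rewrite -[f z]subr0.
apply: (@comparison x0 s f 0 (fun=> 0)) => //; try by move=> *; rewrite subr0; exact: bf.
- exact/continuous_subspaceT/ispoly_continuous.
- move=> Q y pQ ys [Qy fQ]; apply: (le_trans (lf _ ys)).
  rewrite -subr_le0 -laplacianB //; apply: laplacian_at_max; first exact: ispolyB.
  by apply: filterS fQ => x; rewrite Qy subrr subr_le0.
- exact: ispoly_cst.
- by move=> y _; rewrite laplacian_cst.
Qed.

End HarmonicPolynomials.

(** * Gradient estimate *)

Section GradientEstimate.
Variables (R : realType) (n : nat).
Notation E := 'rV[R]_n.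
Notation "''e_' i" := (Defs.basis R i) (at level 8, i at level 2).
Implicit Types (f g P Q w : E -> R) (x y z v : E) (s c M : R).

Definition harmonic_on x s P := forall z, sqdist x z < s -> laplacian P z = 0.

(** The Laplacian commutes with [dird v], and that of [P] vanishes on a whole neighbourhood of each
    point of the open ball. *)
Lemma harmonic_on_dird x s P v : ispoly P -> harmonic_on x s P ->
  harmonic_on x s (dird v P).
Proof.
move=> pP hP z zs; rewrite laplacian_dird // -dirdE.
rewrite (@near_eq_derive _ _ _ _ (cst 0)) ?derive_cst //.
by apply: filterS (nbhs_cball zs) => y; exact: hP.
Qed.

Lemma laplacian_sqr f x : ispoly f -> laplacian (fun y => f y * f y) x =
  2 * (f x * laplacian f x) + 2 * \sum_i dird 'e_i f x ^+ 2.
Proof.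
by move=> pf; rewrite laplacianM //; ring.
Qed.

(* Bernstein's auxiliary function: [eta] vanishes on the sphere, and the term
   [lambda P^2] absorbs the gradients of [eta]. *)
Lemma gradient_estimate x0 s P M i z : (0 < n)%N -> 0 < s ->
  ispoly P -> harmonic_on x0 s P ->
  (forall y, sqdist x0 y = s -> `|P y| <= M) -> cball x0 s z ->
  ((s - sqdist x0 z) * dird 'e_i P z) ^+ 2 <= (2 * n%:R + 16) * s * M ^+ 2.
Proof.
move=> n0 s0 pP hP PM zs; set q := dird 'e_i P; set lam := _ * s.
have n0' : 0 <= n%:R :> R by [].
have lam0 : 0 <= lam by rewrite mulr_ge0 ?ltW //; lra.
have pq : ispoly q by exact: ispoly_dird.
have hq : harmonic_on x0 s q by exact: harmonic_on_dird.
pose eta y := s - sqdist x0 y.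
have pS := ispoly_sqdist x0.
have peta : ispoly eta by apply: ispolyB => //; exact: ispoly_cst.
have deta j : dird 'e_j eta = fun y => - (2 * (y 0 j - x0 0 j)).
  rewrite dirdB ?dird_cst ?dird_sqdist //; last exact: ispoly_cst.
  by apply/funext => y; rewrite sub0r.
have leta y : laplacian eta y = - (2 * n%:R).
  rewrite laplacianB ?laplacian_cst ?laplacian_sqdist ?sub0r //.
  exact: ispoly_cst.
pose h y := eta y * q y.
have ph : ispoly h by exact: ispolyM.
pose F y := h y * h y + lam * (P y * P y).
have pPP : ispoly (fun y => lam * (P y * P y)).
  by apply: ispolyM; [exact: ispoly_cst|exact: ispolyM].
have pF : ispoly F by apply: ispolyD => //; exact: ispolyM.
suff H : F z <= lam * M ^+ 2.
  apply: le_trans H; rewrite /F /h expr2 lerDl.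
  by rewrite mulr_ge0 // -expr2 sqr_ge0.
apply: (max_principle n0 pF _ _ zs) => y ys; last first.
  rewrite /F /h /eta ys subrr mul0r mul0r add0r ler_wpM2l // -expr2.
  by rewrite -real_normK ?num_real // lerXn2r ?nnegrE ?(le_trans (normr_ge0 _) (PM _ ys)) ?PM.
(* Half the Laplacian of [F] is [A + 2 h B - 2 n h q] plus [lam] times the squared gradient of [P].
   The first terms lose at most [(12 + 2 n) s q^2], and the last one is at least
   [(2 n + 16) s q^2]. *)
rewrite /F laplacianD //; last exact: ispolyM.
rewrite laplacianZ; last exact: ispolyM.
rewrite !laplacian_sqr // hP // mulr0 mulr0 add0r.
rewrite [laplacian h y]laplacianM // hq // mulr0 add0r leta.
have Pq : q y ^+ 2 <= \sum_j dird 'e_j P y ^+ 2.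
  by rewrite (bigD1 i) //= lerDl; apply: sumr_ge0 => j _; exact: sqr_ge0.
have dh j : dird 'e_j h y = eta y * dird 'e_j q y - 2 * (y 0 j - x0 0 j) * q y.
  by rewrite dirdM // deta; ring.
have eta0 : 0 <= eta y by rewrite subr_ge0 ltW.
have etas : eta y <= s by rewrite /eta; have := sqdist_ge0 x0 y; lra.
set A := \sum_j dird 'e_j h y ^+ 2.
set B := \sum_j dird 'e_j eta y * dird 'e_j q y.
(* Complete the square in each coordinate; note [|grad eta|^2 <= 4 s]. *)
have AB : - (12 * s * q y ^+ 2) <= A + 2 * (h y * B).
  rewrite /A /B !mulr_sumr -big_split /=.
  apply: (@le_trans _ _ (\sum_j - (12 * (y 0 j - x0 0 j) ^+ 2 * q y ^+ 2))).
    rewrite sumrN lerN2 -mulr_suml -mulr_sumr -sqdistE.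
    by rewrite ler_wpM2r ?sqr_ge0 // ler_wpM2l // ltW.
  apply: ler_sum => j _; rewrite dh deta /h.
  set a := eta y * dird _ _ _; set b := (y 0 j - x0 0 j) * q y.
  have -> : 2 * (eta y * q y * (- (2 * (y 0 j - x0 0 j)) * dird 'e_j q y)) =
    - (4 * (a * b)) by rewrite /a /b; ring.
  have -> : a - 2 * (y 0 j - x0 0 j) * q y = a - 2 * b by rewrite /b; ring.
  have -> : 12 * (y 0 j - x0 0 j) ^+ 2 * q y ^+ 2 = 12 * b ^+ 2 by rewrite /b; ring.
  have := sqr_ge0 (a - 4 * b); nra.
have hq2 : - (h y * (q y * (2 * n%:R))) >= - (2 * n%:R * s * q y ^+ 2).
  rewrite lerN2 /h; have -> : eta y * q y * (q y * (2 * n%:R)) =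
    2 * n%:R * eta y * q y ^+ 2 by ring.
  by rewrite ler_wpM2r ?sqr_ge0 // ler_wpM2l //; lra.
have : 0 <= lam * (\sum_j dird 'e_j P y ^+ 2 - q y ^+ 2).
  by rewrite mulr_ge0 // subr_ge0.
have : 0 <= s * q y ^+ 2 by rewrite mulr_ge0 ?sqr_ge0 // ltW.
rewrite /lam; nra.
Qed.

End GradientEstimate.

(** * Limits with an explicit rate *)

Section Limits.
Variable R : realType.
Implicit Types (x y c : R) (h e : nat -> R).

Lemma le_of_le_add_harmonic x y c :
  (forall k, x <= y + c * k.+1%:R^-1) -> x <= y.
Proof.
move=> xy; rewrite leNgt; apply/negP => yx.
have d0 : 0 < x - y by rewrite subr_gt0.
pose k := (Num.truncn (c / (x - y))).+1.
have kP : c / (x - y) < k%:R by apply: truncnS_gt.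
have := xy k; rewrite -lerBlDl ler_pdivlMr ?ltr0n // => h.
rewrite ltr_pdivrMr // in kP.
have : k.+1%:R = k%:R + 1 :> R by rewrite -natr1.
move: h; nra.
Qed.

(** The intervals of centre [h k] and radius [e k] meet pairwise, so the supremum of their left ends
    lies in all of them. *)
Lemma exists_limit_rate h e : (forall k m, `|h k - h m| <= e k + e m) ->
  exists a, forall k, `|h k - a| <= e k.
Proof.
move=> he; pose S := [set h k - e k | k in setT].
have ubS m : ubound S (h m + e m).
  by move=> _ [k _ <-]; have := he k m; rewrite ler_norml; lra.
have S0 : S !=set0 by exists (h 0%N - e 0%N), 0%N.
exists (sup S) => k; rewrite ler_norml; apply/andP; split.
  have : sup S <= h k + e k by apply: ge_sup.
  lra.
have : h k - e k <= sup S by apply: ub_le_sup; [exists (h 0%N + e 0%N)|exists k].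
lra.
Qed.

End Limits.

(** * Interior bounds for derivatives up to order three *)

Section DerivativeBounds.
Variables (R : realType) (n : nat).
Hypothesis n0 : (0 < n)%N.
Notation E := 'rV[R]_n.
Notation "''e_' i" := (Defs.basis R i) (at level 8, i at level 2).
Implicit Types (f g P Q w : E -> R) (x y z v : E) (s c M : R).

Lemma gradient_bound s : 0 < s -> exists2 C, 0 <= C &
  forall x0 P M, ispoly P -> harmonic_on x0 s P ->
    (forall y, cball x0 s y -> `|P y| <= M) ->
    forall i z, cball x0 (s / 4) z -> `|dird 'e_i P z| <= C * M.
Proof.
move=> s0; pose D : R := (2 * n%:R + 16) * s * (4 / (3 * s)) ^+ 2.
have n0' : 0 <= n%:R :> R by [].
have D0 : 0 <= D.
  by rewrite mulr_ge0 ?sqr_ge0 // mulr_ge0 ?ltW //; lra.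
(* [D] bounds the square of the derivative, and [D <= (1 + D) ^+ 2] avoids a square root. *)
exists (1 + D); first by rewrite addr_ge0.
move=> x0 P M pP hP PM i z zs; set q := dird _ _ _.
have zs' : cball x0 s z by apply: (le_trans zs); lra.
have M0 : 0 <= M by apply: le_trans (PM _ zs').
have bd y : sqdist x0 y = s -> `|P y| <= M.
  by move=> ys; apply: PM; rewrite /cball /= ys.
have := gradient_estimate i n0 s0 pP hP bd zs'.
rewrite -/q exprMn => H.
have e1 : (3 * s / 4) ^+ 2 <= (s - sqdist x0 z) ^+ 2.
  by rewrite lerXn2r ?nnegrE //; move: zs; rewrite /cball /=; lra.
have q2 : q ^+ 2 <= D * M ^+ 2.
  have H' : (3 * s / 4) ^+ 2 * q ^+ 2 <= (2 * n%:R + 16) * s * M ^+ 2.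
    by apply: le_trans H; rewrite ler_wpM2r ?sqr_ge0.
  have -> : D * M ^+ 2 = (4 / (3 * s)) ^+ 2 * ((2 * n%:R + 16) * s * M ^+ 2).
    by rewrite /D; ring.
  have -> : q ^+ 2 = (4 / (3 * s)) ^+ 2 * ((3 * s / 4) ^+ 2 * q ^+ 2).
    by field; rewrite gt_eqF.
  by rewrite ler_wpM2l ?sqr_ge0.
have CM0 : 0 <= (1 + D) * M by rewrite mulr_ge0 // addr_ge0.
rewrite -(@ler_pXn2r _ 2) ?nnegrE // real_normK ?num_real //.
apply: (le_trans q2); rewrite exprMn ler_wpM2r ?sqr_ge0 //; nra.
Qed.

(** Derivatives of harmonic polynomials are harmonic, so the gradient bound can be iterated. Each of
    the three rounds halves the radius, that is, divides [s] by 4, whence [64]. *)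
Lemma derivative_bounds s : 0 < s -> exists2 C, 0 <= C &
  forall x0 P M, ispoly P -> harmonic_on x0 s P ->
    (forall y, cball x0 s y -> `|P y| <= M) ->
    forall i j k z, cball x0 (s / 64) z ->
    [/\ `|dird 'e_i P z| <= C * M, `|dird 'e_j (dird 'e_i P) z| <= C * M &
        `|dird 'e_k (dird 'e_j (dird 'e_i P)) z| <= C * M].
Proof.
move=> s0; have s10 : 0 < s / 4 by rewrite divr_gt0.
have s20 : 0 < s / 4 / 4 by rewrite divr_gt0.
have [C1 C10 B1] := gradient_bound s0; have [C2 C20 B2] := gradient_bound s10.
have [C3 C30 B3] := gradient_bound s20.
have sub x0 P (r t : R) : r <= t -> harmonic_on x0 t P -> harmonic_on x0 r P.
  by move=> rt hP z zr; apply: hP; exact: lt_le_trans rt.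
exists (C1 + C2 * C1 + C3 * (C2 * C1)); first by rewrite !addr_ge0 ?mulr_ge0.
move=> x0 P M pP hP PM i j k z zs.
have M0 : 0 <= M by apply: le_trans (PM x0 _); rewrite // /cball /= sqdistxx ltW.
have D1 := B1 x0 P M pP hP PM i.
have pi : ispoly (dird 'e_i P) by exact: ispoly_dird.
have hi : harmonic_on x0 (s / 4) (dird 'e_i P).
  by apply: (sub _ _ _ s); [lra|exact: harmonic_on_dird].
have D2 := B2 x0 _ (C1 * M) pi hi D1 j.
have pj : ispoly (dird 'e_j (dird 'e_i P)) by exact: ispoly_dird.
have hj : harmonic_on x0 (s / 4 / 4) (dird 'e_j (dird 'e_i P)).
  by apply: (sub _ _ _ (s / 4)); [lra|exact: harmonic_on_dird].
have D3 := B3 x0 _ (C2 * (C1 * M)) pj hj D2 k.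
have a1 : 0 <= C1 * M by rewrite mulr_ge0.
have a2 : 0 <= C2 * (C1 * M) by rewrite mulr_ge0.
have a3 : 0 <= C3 * (C2 * (C1 * M)) by rewrite mulr_ge0.
have eC : (C1 + C2 * C1 + C3 * (C2 * C1)) * M =
  C1 * M + C2 * (C1 * M) + C3 * (C2 * (C1 * M)) by ring.
have w1 : cball x0 (s / 4) z by apply: (le_trans zs); lra.
have w2 : cball x0 (s / 4 / 4) z by apply: (le_trans zs); lra.
have w3 : cball x0 (s / 4 / 4 / 4) z by apply: (le_trans zs); lra.
by rewrite eC; split; [have := D1 z w1|have := D2 z w2|have := D3 z w3]; lra.
Qed.

Lemma poly_bounded_on_cball (I : finType) (F : I -> E -> R) x0 s :
  (forall i, ispoly (F i)) ->
  exists2 B, 0 <= B & forall i z, cball x0 s z -> `|F i z| <= B.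
Proof.
move=> pF; have [[y0 ys]|e0] := pselect (cball x0 s !=set0); last first.
  by exists 0 => // i z zs; case: e0; exists z.
(* A single polynomial dominates the whole family, because [|t| <= t^2 + 1]. *)
pose G z := \sum_i F i z * F i z + 1.
have pG : ispoly G.
  by apply: ispolyD; [apply: ispoly_sum => i; exact: ispolyM|exact: ispoly_cst].
have cG : {within cball x0 s, continuous G}.
  exact/continuous_subspaceT/ispoly_continuous.
have [z _ zmax] := EVT_max_rV (ex_intro _ y0 ys : cball x0 s !=set0)
  (@compact_cball _ _ x0 s) cG.
have sq0 (i : I) y : 0 <= F i y * F i y by rewrite -expr2 sqr_ge0.
exists (G z) => [|i y {}ys]; first by rewrite addr_ge0 // sumr_ge0.
have := zmax y; rewrite inE => /(_ ys); apply: le_trans.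
rewrite /G (bigD1 i) //=.
have h1 : 0 <= \sum_(j | j != i) F j y * F j y by apply: sumr_ge0.
have := sqr_ge0 (`|F i y| - 1); have := real_normK (num_real (F i y)).
rewrite !expr2; nra.
Qed.

End DerivativeBounds.

(** * Second-order expansion of limits of polynomials *)

Section Expansion.
Variables (R : realType) (n : nat).
Hypothesis n0 : (0 < n)%N.
Notation E := 'rV[R]_n.
Notation "''e_' i" := (Defs.basis R i) (at level 8, i at level 2).
Implicit Types (f g P Q w : E -> R) (x y z v : E) (s c M : R).

Lemma dird_le g v z c : ispoly g -> 0 <= c ->
  (forall i, `|dird 'e_i g z| <= c) -> `|dird v g z| <= n%:R * `|v| * c.
Proof.
move=> pg c0 gc; rewrite (dird_basis _ _ pg); apply: (le_trans (ler_norm_sum _ _ _)).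
apply: (@le_trans _ _ (\sum_(i < n) `|v| * c)).
  by apply: ler_sum => i _; rewrite normrM ler_pM ?coord_le_mxnorm ?gc.
by rewrite sumr_const card_ord -mulrA mulr_natl.
Qed.

Lemma dird3_le f v z c : ispoly f -> 0 <= c ->
  (forall i j k, `|dird 'e_k (dird 'e_j (dird 'e_i f)) z| <= c) ->
  `|dird v (dird v (dird v f)) z| <= n%:R ^+ 3 * c * `|v| ^+ 3.
Proof.
move=> pf c0 fc; have pD := ispoly_dird.
have -> : n%:R ^+ 3 * c * `|v| ^+ 3 = n%:R * `|v| * (n%:R * `|v| * (n%:R * `|v| * c)).
  by ring.
have m0 t : 0 <= t -> 0 <= n%:R * `|v| * t by move=> t0; rewrite !mulr_ge0.
apply: dird_le => [||i]; [exact/pD/pD|exact/m0/m0|].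
(* The basis derivative is moved innermost, which leaves a derivative along [v] outermost for the
   next use of [dird_le]. *)
rewrite dirdC ?[dird _ (dird v f)]dirdC //; last exact: pD.
apply: dird_le => [||j]; [exact/pD/pD|exact/m0|].
rewrite dirdC; last exact: pD.
by apply: dird_le => [||k]; [exact/pD/pD| |].
Qed.

Lemma dird2_basis f v z : ispoly f -> dird v (dird v f) z =
  \sum_i (\sum_j dird 'e_j (dird 'e_i f) z * v 0 j) * v 0 i.
Proof.
move=> pf; rewrite dird_basis; last exact: ispoly_dird.
apply: eq_bigr => i _; rewrite mulrC; congr (_ * _).
rewrite dirdC // dird_basis; last exact: ispoly_dird.
by apply: eq_bigr => j _; rewrite mulrC.
Qed.

Lemma dot_mxapp (A : 'M[R]_n) y :
  Defs.dot (mxapp A y) y = \sum_i (\sum_j A i j * y 0 j) * y 0 i.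
Proof.
apply: eq_bigr => i _; congr (_ * _); rewrite /mxapp !mxE.
by apply: eq_bigr => j _; rewrite mxE.
Qed.

Lemma sqdist_line x y (t : R) : sqdist x (x + t *: y) = t ^+ 2 * sqdist x (x + y).
Proof.
rewrite !sqdistE mulr_sumr; apply: eq_bigr => i _; rewrite !mxE -exprMn.
by congr (_ ^+ 2); ring.
Qed.

(** The differences [P k - P m] are harmonic and at most [e k + e m], so their derivatives are
    controlled near [x0]. The gradients and Hessians of [P k] at [x0] converge to [b] and [A], third
    derivatives stay bounded uniformly in [k], and Taylor's formula for [P k] passes to the
    limit. *)
Lemma second_order_expansion x0 s w (P : nat -> E -> R) : 0 < s ->
  (forall k, ispoly (P k)) ->
  (forall k z, sqdist x0 z < s -> laplacian (P k) z = 1) ->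
  (forall k z, cball x0 s z -> `|P k z - w z| <= k.+1%:R^-1) ->
  exists (b : E) (A : 'M[R]_n) (K : R), [/\ A^T = A, \tr A = 1 &
    forall y, cball x0 (s / 64) (x0 + y) ->
      `|w (x0 + y) - w x0 - Defs.dot b y - 2^-1 * Defs.dot (mxapp A y) y|
        <= K * `|y| ^+ 3].
Proof.
move=> s0 pP lP Pw; have [C C0 HC] := derivative_bounds n0 s0.
have c00 : cball x0 (s / 64) x0 by rewrite /cball /= sqdistxx divr_ge0 ?ltW.
have pD := ispoly_dird.
pose e k : R := k.+1%:R^-1.
have e0 k : 0 <= e k by rewrite invr_ge0.
have bd k m z (zs : cball x0 (s / 64) z) i j l :
  [/\ `|dird 'e_i (P k) z - dird 'e_i (P m) z| <= C * (e k + e m),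
      `|dird 'e_j (dird 'e_i (P k)) z - dird 'e_j (dird 'e_i (P m)) z| <= C * (e k + e m) &
      `|dird 'e_l (dird 'e_j (dird 'e_i (P k))) z -
        dird 'e_l (dird 'e_j (dird 'e_i (P m))) z| <= C * (e k + e m)].
  have pB : ispoly (fun x => P k x - P m x) by exact: ispolyB.
  have hB : harmonic_on x0 s (fun x => P k x - P m x).
    by move=> x xs; rewrite laplacianB // !lP // subrr.
  have := HC x0 _ (e k + e m) pB hB _ i j l z zs.
  rewrite dirdB // dirdB; [|exact: pD..]; rewrite dirdB; [|exact/pD/pD..].
  apply=> y ys; have := Pw k y ys; have := Pw m y ys.
  by rewrite -/(e k) -/(e m) !ler_norml; lra.
have lim1 i : exists a, forall k, `|dird 'e_i (P k) x0 - a| <= C * e k.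
  apply: exists_limit_rate => k m; rewrite -mulrDr.
  by have [] := bd k m x0 c00 i i i.
have [b bP] := choice lim1.
have lim2 ij : exists a, forall k,
    `|dird 'e_ij.2 (dird 'e_ij.1 (P k)) x0 - a| <= C * e k.
  apply: exists_limit_rate => k m; rewrite -mulrDr.
  by have [] := bd k m x0 c00 ij.1 ij.2 ij.1.
have [a aP] := choice lim2.
pose A : 'M[R]_n := \matrix_(i, j) a (i, j).
have AP i j k : `|dird 'e_j (dird 'e_i (P k)) x0 - A i j| <= C * e k.
  by rewrite mxE; exact: (aP (i, j)).
have eq_of_le (p q c : R) : (forall k, `|p - q| <= c * e k) -> p = q.
  move=> h; apply/eqP; rewrite -subr_eq0 -normr_le0.
  by apply: (@le_of_le_add_harmonic _ _ _ c) => k; rewrite add0r; exact: h.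
have AT : A^T = A.
  apply/matrixP => i j; rewrite [LHS]mxE.
  apply: (eq_of_le _ _ (C + C)) => k.
  have := AP i j k; have := AP j i k; rewrite dirdC //.
  by rewrite !ler_norml; lra.
have trA : \tr A = 1.
  apply: (eq_of_le _ _ (n%:R * C)) => k.
  have z0 : sqdist x0 x0 < s by rewrite sqdistxx.
  rewrite -[X in _ - X](lP k x0 z0) laplacianE /mxtrace -sumrB.
  apply: (le_trans (ler_norm_sum _ _ _)).
  apply: (@le_trans _ _ (\sum_(i < n) C * e k)).
    by apply: ler_sum => i _; rewrite distrC; exact: AP.
  by rewrite sumr_const card_ord -mulrA mulr_natl.
(* Third derivatives are bounded for [P 0], then for every [P k] by comparison with [P 0], using
   [e k + e 0 <= 2]. *)
have [B B0 HB] := @poly_bounded_on_cball R n ('I_n * 'I_n * 'I_n)%type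
  (fun ijl => dird 'e_ijl.2 (dird 'e_ijl.1.2 (dird 'e_ijl.1.1 (P 0%N)))) x0 (s / 64)
  (fun _ => pD _ _ _ _ (pD _ _ _ _ (pD _ _ _ _ (pP 0%N)))).
pose B' := B + C * 2.
have B'0 : 0 <= B' by rewrite addr_ge0 // mulr_ge0.
have e1 k : e k <= 1 by rewrite invf_le1 ?ltr0n // ler1n.
have bd3 k z (zs : cball x0 (s / 64) z) i j l :
    `|dird 'e_l (dird 'e_j (dird 'e_i (P k))) z| <= B'.
  have [_ _] := bd k 0%N z zs i j l; have /= := HB (i, j, l) z zs.
  have : C * (e k + e 0%N) <= C * 2.
    by rewrite ler_wpM2l //; have := e1 k; have := e1 0%N; lra.
  by rewrite /B' !ler_norml; lra.
exists (\row_i b i), A, (n%:R ^+ 3 * B'); split => // y ys.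
(* The error of replacing [P k] by [w], [b] and [A] is at most [c * e k]: the summand 2 comes from
   the two values of [w], the others from the linear and quadratic terms. *)
pose c := 2 + \sum_i C * `|y 0 i| + 2^-1 * \sum_i (\sum_j C * `|y 0 j|) * `|y 0 i|.
apply: (@le_of_le_add_harmonic _ _ _ c) => k.
have yt t : 0 <= t <= 1 -> cball x0 (s / 64) (x0 + t *: y).
  move=> /andP[t0 t1]; rewrite /cball /= sqdist_line; apply: le_trans ys.
  by rewrite ler_piMl ?sqdist_ge0 // expr_le1.
have T : `|P k (x0 + y) - P k x0 - dird y (P k) x0 -
    2^-1 * dird y (dird y (P k)) x0| <= n%:R ^+ 3 * B' * `|y| ^+ 3.
  apply: taylor_poly => // t t01; apply: dird3_le => // i j l.
  exact/bd3/yt.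
have sub z : cball x0 (s / 64) z -> cball x0 s z by move=> zs; apply: (le_trans zs); lra.
have E0 := Pw k x0 (sub _ c00); have E1 := Pw k _ (sub _ ys).
rewrite -/(e k) in E0 E1 *.
have E2 : `|dird y (P k) x0 - Defs.dot (\row_i b i) y| <= (\sum_i C * `|y 0 i|) * e k.
  rewrite (dird_basis _ _ (pP k)) -sumrB mulr_suml.
  apply: (le_trans (ler_norm_sum _ _ _)); apply: ler_sum => i _.
  by rewrite mxE [b i * _]mulrC -mulrBr normrM mulrAC mulrC ler_wpM2r ?bP.
have E3 : `|dird y (dird y (P k)) x0 - Defs.dot (mxapp A y) y| <=
    (\sum_i (\sum_j C * `|y 0 j|) * `|y 0 i|) * e k.
  rewrite (dird2_basis _ _ (pP k)) dot_mxapp -sumrB mulr_suml.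
  apply: (le_trans (ler_norm_sum _ _ _)); apply: ler_sum => i _.
  rewrite -mulrBl normrM mulrAC ler_wpM2r // -sumrB mulr_suml.
  apply: (le_trans (ler_norm_sum _ _ _)); apply: ler_sum => j _.
  by rewrite -mulrBl normrM mulrAC ler_wpM2r ?AP.
rewrite /c !mulrDl -mulrA; move: T E0 E1 E2 E3; rewrite !ler_norml; lra.
Qed.

End Expansion.

(** * The Dirichlet problem with polynomial data *)

(* By Cayley-Hamilton [L] is annihilated by some [q X^m] with [q(0) != 0]; on the
   quotient by [K], where [L] is injective, already [q(L) = 0]. *)
Lemma surjective_of_injective_mod (F : fieldType) N (L : 'M[F]_N.+1)
    (K : 'rV[F]_N.+1 -> Prop) :
  K 0 -> (forall a x, K x -> K (a *: x)) ->
  (forall c, K (c *m L) -> K c) -> forall c, exists c', K (c - c' *m L).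
Proof.
move=> K0 KZ KL c.
have [m [q]] := multiplicity_XsubC (char_poly L) 0.
rewrite monic_neq0 ?char_poly_monic //= => q0 Eq.
have := Cayley_Hamilton L; rewrite Eq rmorphM rmorphXn /= rmorphB /= horner_mx_X.
rewrite horner_mx_C raddf0 subr0 => qL.
have {qL} : K (c *m horner_mx L q *m L ^+ m).
  by rewrite -mulmxA -[X in K (c *m X)]/(_ * _) qL mulmx0.
elim: m {Eq} => [|m IH]; last first.
  by rewrite exprSr -[_ * L]/(_ *m _) mulmxA => /KL; exact: IH.
rewrite expr0 mulmx1 => Kq.
(* Writing [q = q(0) + r X] turns [q(L) = 0] modulo [K] into a formula for a preimage under [L],
   after division by [q(0)]. *)
have /factor_theorem[r rE] : root (q - q.[0]%:P) 0.
  by rewrite /root !hornerE subrr.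
have qE : q = q.[0]%:P + r * ('X - 0%:P) by rewrite -rE addrC subrK.
move: Kq; rewrite qE rmorphD rmorphM rmorphB /= horner_mx_X !horner_mx_C.
rewrite raddf0 subr0 mulmxDr mul_mx_scalar -[_ * L]/(_ *m _) mulmxA.
move=> /(KZ (q.[0])^-1) Kq; exists (- (q.[0])^-1 *: (c *m horner_mx L r)).
by move: Kq; rewrite scalerDr scalerA mulVf // scale1r -scalemxAl scaleNr opprK.
Qed.

Section Dirichlet.
Variables (R : realType) (n : nat).
Notation E := 'rV[R]_n.
Implicit Types (f g P Q w : E -> R) (x y z v : E) (s c M : R) (d : nat).

Lemma polydeg0_cst f : polydeg 0 f -> exists c, f = fun=> c.
Proof.
suff H d : polydeg d f -> d = 0%N -> exists c, f = fun=> c by move=> /H; exact.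
move=> pf; elim: pf => {d f} [d c|d f g _ IHf _ IHg|//|//] d0; first by exists c.
have [[cf ->] [cg ->]] := (IHf d0, IHg d0); by exists (cf + cg).
Qed.

(** Lowering the degree by splitting off coordinates is the inductive step for finite spanning
    families. *)
Lemma polydegS_decomp d f : polydeg d.+1 f ->
  exists f0 (F : 'I_n -> E -> R), [/\ polydeg d f0, forall i, polydeg d (F i) &
    f = fun x => f0 x + \sum_i x 0 i * F i x].
Proof.
have p0 d' := @polydeg_cst R n d' 0.
have sum0 x : \sum_(i < n) x 0 i * 0 = 0 :> R.
  by rewrite big1 // => i _; rewrite mulr0.
move=> pf; have [k kd] : exists k, k = d.+1 by exists d.+1.
rewrite -kd in pf; elim: pf kd => {k f} [k c|k f g _ IHf _ IHg|k f i pf _|k f pf _] kd.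
- exists (fun=> c), (fun _ _ => 0); split=> [|i|]; [exact: polydeg_cst..|].
  by apply/funext => x; rewrite sum0 addr0.
- have [f0 [F [pf0 pF ->]]] := IHf kd; have [g0 [G [pg0 pG ->]]] := IHg kd.
  exists (fun x => f0 x + g0 x), (fun i x => F i x + G i x); split.
  + exact: polydegD.
  + by move=> i; exact: polydegD.
  + apply/funext => x; rewrite addrACA -big_split; congr (_ + _).
    by apply: eq_bigr => i _; rewrite mulrDr.
- case: kd pf => -> pf; exists (fun=> 0), (fun j x => if j == i then f x else 0).
  split => //; first by move=> j; case: (j == i) => //; exact: p0.
  apply/funext => x; rewrite add0r (bigD1 i) //= eqxx big1 ?addr0 // => j /negbTE->.
  by rewrite mulr0.
- case: kd pf => -> pf; exists f, (fun _ _ => 0); split => //.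
  by apply/funext => x; rewrite sum0 addr0.
Qed.

(** A family for degree [d], together with its products by the coordinates, spans degree [d.+1].
    Nonemptiness lets the index set become ['I_N.+1], the form in which Cayley-Hamilton is
    applied. *)
Lemma polydeg_finite_span d : exists (I : finType) (g : I -> E -> R),
  [/\ (0 < #|I|)%N, forall k, polydeg d (g k) &
  forall f, polydeg d f -> exists c : I -> R, forall x, f x = \sum_k c k * g k x].
Proof.
elim: d => [|d [I [g [I0 pg sg]]]].
  exists unit, (fun _ _ => 1); split=> [|k|f /polydeg0_cst[c ->]].
  - by rewrite card_unit.
  - exact: polydeg_cst.
  - by exists (fun=> c) => x; rewrite (big_pred1 tt) ?mulr1 // => -[].
exists (I + 'I_n * I)%type,
  (fun k => match k with inl k => g k | inr p => fun x => x 0 p.1 * g p.2 x end).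
split=> [|[k|p]|f].
- by rewrite card_sum addn_gt0 I0.
- exact: polydegS.
- exact: polydegX.
move=> /polydegS_decomp[f0 [F [pf0 pF ->]]].
have [c0 f0E] := sg _ pf0.
have [c cE] := choice (fun i => sg _ (pF i)).
exists (fun k => match k with inl k => c0 k | inr p => c p.1 p.2 end) => x.
rewrite big_sumType /= f0E; congr (_ + _).
rewrite -(pair_bigA _ (fun i k => c i k * (x 0 i * g k x))) /=.
apply: eq_bigr => i _; rewrite cE mulr_sumr.
by apply: eq_bigr => k _; rewrite mulrCA.
Qed.

Definition lincomb N (g : 'I_N -> E -> R) (c : 'rV[R]_N) : E -> R :=
  fun x => \sum_k c 0 k * g k x.

Lemma polydeg_span d : exists N (g : 'I_N.+1 -> E -> R),
  (forall k, polydeg d (g k)) /\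
  forall f, polydeg d f -> exists a : 'rV_N.+1, f = lincomb g a.
Proof.
have [I [g [I0 pg sg]]] := polydeg_finite_span d.
have EI : #|I| = #|I|.-1.+1 by rewrite prednK.
pose h (k : 'I_(#|I|.-1.+1)) : I := enum_val (cast_ord (esym EI) k).
exists #|I|.-1, (fun k => g (h k)); split=> // f pf.
have [c cE] := sg f pf; exists (\row_k c (h k)); apply/funext => x.
rewrite cE /lincomb (reindex h) /=; first by apply: eq_bigr => k _; rewrite mxE.
exists (fun i => cast_ord EI (enum_rank i)) => [k _|i _].
  by rewrite /h enum_valK cast_ordKV.
by rewrite /h cast_ordK enum_rankK.
Qed.

Lemma polydeg_sqdist x : polydeg 2 (sqdist x).
Proof.
have p1 i : polydeg 1 (fun y : E => y 0 i - x 0 i).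
  apply: polydegD; last exact: polydeg_cst.
  have -> : (fun y : E => y 0 i) = fun y => y 0 i * 1.
    by apply/funext => y; rewrite mulr1.
  exact/polydegX/polydeg_cst.
rewrite sqdist_fun; apply: polydeg_sum => i; exact: (@polydegM _ _ 1 1).
Qed.

Hypothesis n0 : (0 < n)%N.

Lemma dirichlet_zero x0 s f : ispoly f -> harmonic_on x0 s f ->
  (forall z, sqdist x0 z = s -> f z = 0) ->
  forall z, cball x0 s z -> f z = 0.
Proof.
move=> pf hf bf z zs; apply/eqP; rewrite eq_le; apply/andP; split.
  apply: (max_principle n0 pf _ _ zs) => y ys; first by rewrite hf.
  by rewrite bf.
rewrite -oppr_le0; apply: (max_principle n0 (ispolyN pf) _ _ zs) => y ys.
  by rewrite laplacianN // hf // oppr0.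
by rewrite bf ?oppr0.
Qed.

Lemma dirichlet x0 s Q : ispoly Q -> exists2 p, ispoly p &
  forall z, sqdist x0 z < s ->
    laplacian (fun x => Q x + (s - sqdist x0 x) * p x) z = 1.
Proof.
move=> pQ; pose eta x := s - sqdist x0 x.
have peta : polydeg 2 eta.
  apply: polydegD; first exact: polydeg_cst.
  have -> : (fun x => - sqdist x0 x) = fun x => -1 * sqdist x0 x.
    by apply/funext => x; rewrite mulN1r.
  exact/polydegZ/polydeg_sqdist.
have ieta : ispoly eta by exists 2%N.
pose T p := laplacian (fun x => eta x * p x).
(* The equation to solve is [T p = 1 - laplacian Q]. Multiplication by [eta] adds 2 to the degree
   bound and the Laplacian removes 2, so [T] acts on polynomials of degree at most [d]. *)
have [d pd] : ispoly (fun x => 1 - laplacian Q x).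
  by apply: ispolyB; [exact: ispoly_cst|exact: ispoly_laplacian].
have [N [g [pg sg]]] := polydeg_span d.
have ig k : ispoly (g k) by exists d.
have pT p : polydeg d p -> polydeg d (T p).
  move=> pp; apply: polydeg_laplacian.
  exact: (@polydegM _ _ 2 d).
have [l lE] := choice (fun k => sg _ (pT _ (pg k))).
pose L : 'M[R]_N.+1 := \matrix_k l k.
have icg (a : 'rV_N.+1) : ispoly (lincomb g a).
  by apply: ispoly_sum => k; apply: ispolyM => //; exact: ispoly_cst.
have TE (a : 'rV_N.+1) x : T (lincomb g a) x = lincomb g (a *m L) x.
  rewrite /T /lincomb.
  have -> : (fun y => eta y * \sum_k a 0 k * g k y) =
      fun y => \sum_k a 0 k * (eta y * g k y).
    by apply/funext => y; rewrite mulr_sumr; apply: eq_bigr => k _; rewrite mulrCA.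
  rewrite laplacian_sum; last first.
    by move=> k; apply: ispolyM; [exact: ispoly_cst|exact: ispolyM].
  under [RHS]eq_bigr do rewrite mxE mulr_suml.
  rewrite [RHS]exchange_big /=; apply: eq_bigr => k _.
  rewrite laplacianZ; last exact: ispolyM.
  rewrite -/(T (g k)) lE /lincomb mulr_sumr; apply: eq_bigr => j _.
  by rewrite mxE mulrA.
(* The spanning family may be dependent, so coefficient rows are identified when their combinations
   agree on the open ball. *)
pose K (a : 'rV_N.+1) := forall z, sqdist x0 z < s -> lincomb g a z = 0.
have [c cE] := sg _ pd.
have [||a|c' Kc'] := @surjective_of_injective_mod R N L K _ _ _ c.
- by move=> z _; rewrite /lincomb big1 // => k _; rewrite mxE mul0r.
- move=> b x Kx z zs; have := Kx z zs; rewrite /lincomb => Kz.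
  under eq_bigr do rewrite mxE -mulrA.
  by rewrite -mulr_sumr Kz mulr0.
(* Injectivity: if [T p] vanishes in the ball, [eta p] is harmonic with zero boundary values, hence
   zero, and [eta > 0] inside. *)
- move=> KaL z zs.
  have : eta z * lincomb g a z = 0.
    apply: (@dirichlet_zero x0 s (fun x => eta x * lincomb g a x)).
    + exact: ispolyM.
    + by move=> y ys; rewrite -/(T _) TE KaL.
    + by move=> y ys; rewrite /eta ys subrr mul0r.
    + by rewrite /cball /= ltW.
  by move/eqP; rewrite mulf_eq0 subr_eq0 gt_eqF //= => /eqP.
- exists (lincomb g c'); first exact: icg.
  move=> z zs; rewrite (laplacianD z pQ (ispolyM ieta (icg c'))).
  rewrite -/(T _) TE; have := Kc' z zs; have /(congr1 (@^~ z)) /= := cE.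
  rewrite /lincomb; under [X in _ -> X = 0 -> _]eq_bigr do rewrite mxE [fun_of_matrix (- _) _ _]mxE mulrBl.
  rewrite sumrB => <-; lra.
Qed.

End Dirichlet.

(** * Polynomial approximation *)

Section Approximation.
Variables (R : realType) (n : nat).
Notation E := 'rV[R]_n.
Notation "''e_' i" := (Defs.basis R i) (at level 8, i at level 2).
Implicit Types (f g P Q w : E -> R) (x y z v : E) (s c M : R) (l : seq 'I_n).

(* Expected value of [g] at the end of a random walk started at [z], whose steps
   in the directions listed in [l] are taken with probabilities [t i x]. *)
Fixpoint walk (h : R) (t : 'I_n -> E -> R) l g z x : R :=
  if l is i :: l' then
    (1 - t i x) * walk h t l' g z x + t i x * walk h t l' g (z + h *: 'e_i) x
  else g z.

Section Walk.
Variables (h : R) (t : 'I_n -> E -> R).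

Lemma ispoly_walk l g z : (forall i, ispoly (t i)) -> ispoly (walk h t l g z).
Proof.
move=> pt; elim: l z => [|i l IH] z /=; first exact: ispoly_cst.
apply: ispolyD; apply: ispolyM => //.
by apply: ispolyB => //; exact: ispoly_cst.
Qed.

Lemma walk_le l g g' z x : (forall i, 0 <= t i x <= 1) ->
  (forall y, g y <= g' y) -> walk h t l g z x <= walk h t l g' z x.
Proof.
move=> t01 gg'; elim: l z => [|i l IH] z //=; have /andP[t0 t1] := t01 i.
by apply: lerD; apply: ler_wpM2l => //; rewrite subr_ge0.
Qed.

Lemma walk_affine l (I : finType) (g : I -> E -> R) (a b : R) z x :
  walk h t l (fun y => a + b * \sum_j g j y) z x =
  a + b * \sum_j walk h t l (g j) z x.
Proof.
elim: l z => [|i l IH] z //=; rewrite !IH big_split /= -!mulr_sumr; ring.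
Qed.

(** Squared bias plus variance: the displacement in direction [j] is [h] times a binomial variable
    with [count_mem j l] trials of probability [t j x]. *)
Lemma walk_sqr l j (a : R) z x :
  walk h t l (fun y => (y 0 j - a) ^+ 2) z x =
  (z 0 j + h * (count_mem j l)%:R * t j x - a) ^+ 2 +
  h ^+ 2 * (count_mem j l)%:R * (t j x * (1 - t j x)).
Proof.
elim: l z => [|i l IH] z /=; first by rewrite !mulr0 !mul0r !addr0.
have zE : (z + h *: 'e_i) 0 j = z 0 j + h * (if i == j then 1 else 0).
  by rewrite mxE [X in _ + X]mxE basisE eq_sym.
by rewrite !IH zE natrD; case: (eqVneq i j) => [->|_] /=; ring.
Qed.

End Walk.

Definition cube x r : set E := [set y | forall i, x 0 i - r <= y 0 i <= x 0 i + r].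

Lemma compact_cube x r : compact (cube x r).
Proof.
have := @rV_compact R n (fun i => `[x 0 i - r, x 0 i + r]%classic)
  (fun i => @segment_compact _ _ _).
congr compact; apply/seteqP; split=> y yc i; have := yc i; by rewrite /= in_itv.
Qed.

(** Heine-Cantor, with continuity in the ambient space, so that [y] may leave [A]. Halving both the
    radius and the tolerance gives an estimate valid for all [x'] near [x], as the covering form of
    compactness requires. *)
Lemma uniformly_continuous_on_compact (A : set E) f e : compact A -> 0 < e ->
  (forall x, A x -> {for x, continuous f}) ->
  exists2 d, 0 < d & forall x y, A x -> `|x - y| < d -> `|f y - f x| <= e.
Proof.
move=> /compact_near_coveringP cA e0 cf.
have := cA R (0^'+) (fun d x => forall y, `|x - y| < d -> `|f y - f x| <= e).
have H x : A x -> \forall x' \near x & d \near 0^'+,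
    forall y, `|x' - y| < d -> `|f y - f x'| <= e.
  move=> Ax; have e20 : 0 < e / 2 by rewrite divr_gt0.
  have /cvgrPdist_le/(_ _ e20) := cf x Ax.
  move=> /nbhs_ballP[r /= r0 rP].
  have r20 : 0 < r / 2 by rewrite divr_gt0.
  exists (ball x (r / 2), [set d | d < r / 2]).
    by split; [exact: nbhsx_ballx|exact: nbhs_right_lt].
  move=> [x' d] /= [xx' dr] y x'y.
  move: xx'; rewrite -ball_normE /= => xx'.
  have bx : `|f x - f x'| <= e / 2.
    by apply: rP; rewrite -ball_normE /=; lra.
  have by' : `|f x - f y| <= e / 2.
    apply: rP; rewrite -ball_normE /=.
    have := ler_distD x' x y; lra.
  have := ler_distD (f x) (f y) (f x'); rewrite [`|f y - f x|]distrC; lra.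
move=> /(_ _ H) H'.
have [d [d0 dP]] : exists d : R, 0 < d /\ forall x, A x ->
    forall y, `|x - y| < d -> `|f y - f x| <= e.
  have : \forall d \near (0 : R)^'+, 0 < d /\ forall x, A x ->
      forall y, `|x - y| < d -> `|f y - f x| <= e.
    by apply: filterI => //; exact: nbhs_right_gt.
  exact: filter_ex.
by exists d => // x y Ax; exact: dP.
Qed.

Lemma mxnorm_sqr_le_sqdist x y : `|x - y| ^+ 2 <= sqdist x y.
Proof.
have q0 := sqdist_ge0 x y.
rewrite -[leRHS](sqr_sqrtr q0) lerXn2r ?nnegrE ?sqrtr_ge0 //.
apply: mxnorm_le => [|i]; first exact: sqrtr_ge0.
rewrite -sqrtr_sqr ler_sqrt // !mxE -sqrrN opprB.
exact: sqr_coord_le_sqdist.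
Qed.

Lemma bounded_on_compact (A : set E) f : compact A ->
  (forall x, A x -> {for x, continuous f}) ->
  exists2 B, 0 <= B & forall x, A x -> `|f x| <= B.
Proof.
move=> cA cf; have [[y0 ys]|e0] := pselect (A !=set0); last first.
  by exists 0 => // z zs; case: e0; exists z.
have cg : {within A, continuous (fun x => `|f x|)}.
  apply: continuous_in_subspaceT => x; rewrite inE => Ax.
  exact: (continuous_comp (cf x Ax) (@norm_continuous _ _ _)).
have [z _ zmax] := EVT_max_rV (ex_intro _ y0 ys : A !=set0) cA cg.
by exists `|f z| => // x Ax; apply: zmax; rewrite inE.
Qed.

(** Near pairs fall under uniform continuity; for far pairs the quadratic term exceeds twice the
    supremum of [f]. A quadratic modulus reduces the approximation error to a variance. *)
Lemma quadratic_modulus (A : set E) f e : compact A -> 0 < e ->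
  (forall x, A x -> {for x, continuous f}) ->
  exists2 K, 0 <= K & forall x y, A x -> A y -> `|f y - f x| <= e + K * sqdist x y.
Proof.
move=> cA e0 cf; have [d d0 dP] := uniformly_continuous_on_compact cA e0 cf.
have [B B0 BP] := bounded_on_compact cA cf.
exists (2 * B / d ^+ 2); first by rewrite divr_ge0 ?sqr_ge0 ?mulr_ge0.
move=> x y Ax Ay; have K0 : 0 <= 2 * B / d ^+ 2 * sqdist x y.
  by rewrite mulr_ge0 ?sqdist_ge0 // divr_ge0 ?sqr_ge0 ?mulr_ge0.
have [xy|xy] := ltP `|x - y| d; first by have := dP x y Ax xy; lra.
have dq : d ^+ 2 <= sqdist x y.
  by apply: le_trans (mxnorm_sqr_le_sqdist x y); rewrite lerXn2r ?nnegrE // ltW.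
have : 2 * B <= 2 * B / d ^+ 2 * sqdist x y.
  by rewrite mulrAC ler_pdivlMr ?exprn_gt0 // ler_wpM2l // mulr_ge0.
have := ler_normB (f y) (f x); have := BP x Ax; have := BP y Ay; lra.
Qed.

Lemma sqr_clamp_le (a b p q : R) : a <= p -> p <= b ->
  (Num.max a (Num.min b q) - p) ^+ 2 <= (q - p) ^+ 2.
Proof.
move=> ap pb; case: (leP b q) => bq.
  have -> : Num.max a b = b by apply/max_idPr/(le_trans ap).
  by rewrite lerXn2r ?nnegrE; lra.
case: (leP a q) => // qa.
by rewrite -sqrrN -[leRHS]sqrrN lerXn2r ?nnegrE; lra.
Qed.

(** Projection onto the cube. Composing with it extends a function from the cube to the whole space,
    and distances to points of the cube do not increase, so the quadratic modulus holds at every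
    point. *)
Definition clamp x r y : E :=
  \row_i Num.max (x 0 i - r) (Num.min (x 0 i + r) (y 0 i)).

Lemma cube_clamp x r y : 0 <= r -> cube x r (clamp x r y).
Proof.
move=> r0 i; rewrite mxE le_max lexx /= ge_max ge_min lexx /= andbT; lra.
Qed.

Lemma sqdist_clamp x r y z : cube x r y -> sqdist y (clamp x r z) <= sqdist y z.
Proof.
move=> yc; rewrite !sqdistE; apply: ler_sum => i _; rewrite mxE.
have /andP[y1 y2] := yc i.
exact: sqr_clamp_le.
Qed.

(** Bernstein's proof of the Weierstrass theorem: from the lower corner of the cube, take [m] steps
    of length [2 r / m] in each direction, with probabilities [t i x] making [x] the mean end point.
    The error is at most [e / 2] plus [K] times the variance. *)
Lemma polynomial_approximation x0 r f e : 0 < r -> 0 < e ->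
  (forall x, cube x0 r x -> {for x, continuous f}) ->
  exists2 Q, ispoly Q & forall x, cube x0 r x -> `|Q x - f x| <= e.
Proof.
move=> r0 e0 cf; have e20 : 0 < e / 2 by rewrite divr_gt0.
have [K K0 KP] := quadratic_modulus (@compact_cube x0 r) e20 cf.
pose t i x : R := (x 0 i - (x0 0 i - r)) / (2 * r).
have pt i : ispoly (t i).
  by apply: ispolyM; [exact: ispoly_coordB|exact: ispoly_cst].
(* Each coordinate has variance at most [4 r^2 / m], so [K] times the total variance is at most
   [c / m], which the choice of [m] puts below [e / 2]. *)
pose c := K * (n%:R * (4 * r ^+ 2)).
have c0 : 0 <= c by rewrite !mulr_ge0 // ltW.
pose m := (Num.truncn (c / (e / 2))).+1.
have mP : c / (e / 2) < m%:R by apply: truncnS_gt.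
have m0 : 0 < m%:R :> R by rewrite ltr0n.
pose h : R := 2 * r / m%:R.
pose l := flatten (nseq m (enum 'I_n)).
have lE j : count_mem j l = m.
  rewrite /l; elim: m {mP m0 h l} => [|k IH] //=.
  by rewrite count_cat IH count_uniq_mem ?enum_uniq // mem_enum.
pose z0 : E := \row_i (x0 0 i - r).
exists (walk h t l (f \o clamp x0 r) z0); first exact: ispoly_walk.
move=> x xc.
have t01 i : 0 <= t i x <= 1.
  have /andP[x1 x2] := xc i.
  by rewrite /t divr_ge0 ?ler_pdivrMr ?mul1r; lra.
have KF z : `|(f \o clamp x0 r) z - f x| <= e / 2 + K * sqdist x z.
  apply: (le_trans (KP x _ xc (cube_clamp _ _ (ltW r0)))).
  by rewrite lerD2l ler_wpM2l // sqdist_clamp.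
have We (a b : R) : walk h t l (fun z => a + b * sqdist x z) z0 x =
    a + b * \sum_j h ^+ 2 * m%:R * (t j x * (1 - t j x)).
  have -> : (fun z => a + b * sqdist x z) =
      fun z => a + b * \sum_j (z 0 j - x 0 j) ^+ 2.
    by apply/funext => z; rewrite sqdistE.
  rewrite walk_affine; congr (_ + _ * _); apply: eq_bigr => j _.
  (* The bias vanishes: the mean end point is [x]. *)
  rewrite walk_sqr lE mxE (_ : _ - x 0 j = 0) ?expr0n ?add0r //.
  by rewrite /h /t; field; rewrite !gt_eqF.
set S := \sum_j _ in We.
have S1 : K * S <= e / 2.
  have S2 : S <= n%:R * (4 * r ^+ 2) / m%:R.
    apply: (@le_trans _ _ (\sum_(j < n) 4 * r ^+ 2 / m%:R)); last first.
      by rewrite sumr_const card_ord -[leRHS]mulrA [leRHS]mulr_natl.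
    apply: ler_sum => j _; have /andP[t0 t1] := t01 j.
    have -> : h ^+ 2 * m%:R = 4 * r ^+ 2 / m%:R.
      by rewrite /h; field; rewrite gt_eqF.
    rewrite ler_piMr //; last by nra.
    by apply: divr_ge0; [nra|exact: ltW].
  apply: (le_trans (ler_wpM2l K0 S2)).
  have -> : K * (n%:R * (4 * r ^+ 2) / m%:R) = c / m%:R by rewrite mulrA.
  rewrite ler_pdivrMr //.
  by move: mP; rewrite ltr_pdivrMr // mulrC => /ltW.
have up : walk h t l (f \o clamp x0 r) z0 x <= (f x + e / 2) + K * S.
  rewrite -We; apply: walk_le => // z.
  by have := KF z; rewrite ler_norml; lra.
have lo : (f x - e / 2) + (- K) * S <= walk h t l (f \o clamp x0 r) z0 x.
  rewrite -We; apply: walk_le => // z.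
  by have := KF z; rewrite ler_norml; lra.
rewrite ler_norml; lra.
Qed.

End Approximation.

(** * Singular points *)

Section SingularPoints.
Variables (R : realType) (n : nat).
Notation E := 'rV[R]_n.
Implicit Types (f g P Q w u v : E -> R) (x y z : E) (s c M r : R).

Lemma nbhs_cube x (U : set E) : nbhs x U -> exists2 r, 0 < r & cube x r `<=` U.
Proof.
move=> /nbhs_ballP[d /= d0 dU]; exists (d / 2); first by rewrite divr_gt0.
move=> y yc; apply: dU; rewrite -ball_normE /=.
apply: (@le_lt_trans _ _ (d / 2)); last lra.
apply: mxnorm_le => [|i]; first lra.
have := yc i; rewrite !mxE ler_norml; lra.
Qed.

Lemma cball_cube x r : 0 < r -> cball x (r ^+ 2) `<=` cube x r.
Proof.
move=> r0 y yr i; have := le_trans (sqr_coord_le_sqdist x y i) yr.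
rewrite -real_normK ?num_real // => yr2.
have : `|y 0 i - x 0 i| <= r by rewrite -(@ler_pXn2r _ 2) ?nnegrE // ltW.
rewrite ler_norml; lra.
Qed.

Lemma open_unit_ball : open (@unit_ball R n).
Proof.
have lt1 (x : E) : (Num.sqrt (Defs.dot x x) < 1) = (Defs.dot x x < 1).
  by rewrite -[X in _ < X]sqrtr1 ltr_sqrt ?ltr01.
have -> : @unit_ball R n = sqdist 0 @^-1` [set r | r < 1].
  by apply/seteqP; split => x; rewrite /unit_ball /= /sqdist subr0 lt1.
apply: open_comp; last exact: open_lt.
by move=> x _; exact/ispoly_continuous/ispoly_sqdist.
Qed.

(** The approximation takes place on the cube, the Dirichlet problem on the inscribed ball. The
    correction vanishes on the sphere, so the error made there propagates inward by comparison from
    both sides. *)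
Lemma visc_laplacian_approximation (U : set E) v x0 r : (0 < n)%N -> 0 < r ->
  cube x0 r `<=` U -> (forall x, U x -> {for x, continuous v}) ->
  visc_eq (@laplacian R n) U (cst 1) v ->
  exists P : nat -> E -> R, [/\ forall k, ispoly (P k),
    forall k z, sqdist x0 z < r ^+ 2 -> laplacian (P k) z = 1 &
    forall k z, cball x0 (r ^+ 2) z -> `|P k z - v z| <= k.+1%:R^-1].
Proof.
move=> n0 r0 cU cv [[_ vle] [_ vge]]; set s := r ^+ 2.
have sU : cball x0 s `<=` U := subset_trans (cball_cube r0) cU.
have cvs : {within cball x0 s, continuous v}.
  by apply: continuous_in_subspaceT => x; rewrite inE => /sU; exact: cv.
suff H (k : nat) : exists P, [/\ ispoly P,
    forall z, sqdist x0 z < s -> laplacian P z = 1 &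
    forall z, cball x0 s z -> `|P z - v z| <= k.+1%:R^-1].
  by have [P PP] := choice H; exists P; split=> k; have [] := PP k.
pose e : R := k.+1%:R^-1; have e0 : 0 < e by rewrite invr_gt0 ltr0n.
have [Q pQ Qv] := polynomial_approximation r0 e0 (fun x xc => cv x (cU x xc)).
have [p pp lp] := dirichlet n0 x0 s pQ.
pose P x := Q x + (s - sqdist x0 x) * p x.
have pP : ispoly P.
  apply: ispolyD => //; apply: ispolyM => //.
  by apply: ispolyB; [exact: ispoly_cst|exact: ispoly_sqdist].
have bP z : sqdist x0 z = s -> `|P z - v z| <= e.
  move=> zs; rewrite /P zs subrr mul0r addr0.
  by apply/Qv/cball_cube => //; rewrite /cball /= zs.
exists P; split => // z zs; rewrite -/e ler_norml; apply/andP; split.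
  rewrite -lerN2 opprK opprB.
  apply: (@comparison R n x0 s v 1 P e n0 cvs) => // [Q' y pQ' ys ta|y ys|y ys].
  - by apply: vge ta; [exact: ispoly_C2|exact/sU/ltW].
  - by rewrite lp.
  - by have := bP y ys; rewrite ler_norml; lra.
(* The other bound is comparison for [- v] and [- P]: touching [- v] from above is touching [v] from
   below by the opposite function. *)
have -> : P z - v z = - v z - - P z by rewrite opprK addrC.
apply: (@comparison R n x0 s (fun x => - v x) (-1) (fun x => - P x) e n0) => //.
- by move=> x; apply: continuousN; exact: cvs.
- move=> Q' y pQ' ys [Qy vQ].
  rewrite -[laplacian Q' y]opprK lerN2 -laplacianN //.
  apply: (vle (fun x => - Q' x)); first exact/ispoly_C2/ispolyN.
    exact/sU/ltW.
  split; first by rewrite Qy opprK.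
  by apply: filterS vQ => x; rewrite lerNl.
- exact: ispolyN.
- by move=> y ys; rewrite laplacianN // lp.
- by move=> y ys; have := bP y ys; rewrite opprK ler_norml; lra.
Qed.

Lemma ge0_of_small (t0 p c : R) : 0 < t0 ->
  (forall t, 0 < t -> t <= t0 -> 0 <= p + c * t) -> 0 <= p.
Proof.
move=> t00 pt; rewrite leNgt; apply/negP => p0.
(* For [t <= - p / d] the term [c * t] is at most [- p / 2], too small to compensate a negative
   [p]. *)
pose d := 2 * (`|c| + 1); have d0 : 0 < d by rewrite mulr_gt0 // ltr_wpDl.
pose t := Num.min t0 (- p / d).
have t0' : 0 < t by rewrite lt_min t00 divr_gt0 // oppr_gt0.
have tt0 : t <= t0 by rewrite ge_min lexx.
have : t <= - p / d by rewrite ge_min lexx orbT.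
rewrite ler_pdivlMr // /d => h.
have := pt t t0' tt0; have := ler_norm c; have := normr_ge0 c; nra.
Qed.

Lemma dotC x y : Defs.dot x y = Defs.dot y x.
Proof. by apply: eq_bigr => i _; rewrite mulrC. Qed.

Lemma dotNr x y : Defs.dot x (- y) = - Defs.dot x y.
Proof. by rewrite /Defs.dot -sumrN; apply: eq_bigr => i _; rewrite mxE mulrN. Qed.

Lemma dotZr x y (t : R) : Defs.dot x (t *: y) = t * Defs.dot x y.
Proof.
by rewrite /Defs.dot mulr_sumr; apply: eq_bigr => i _; rewrite mxE mulrCA.
Qed.

Lemma dot_mxappZ (A : 'M[R]_n) y (t : R) :
  Defs.dot (mxapp A (t *: y)) (t *: y) = t ^+ 2 * Defs.dot (mxapp A y) y.
Proof.
have -> : mxapp A (t *: y) = t *: mxapp A y.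
  by rewrite /mxapp linearZ /= -scalemxAr linearZ.
by rewrite dotZr dotC dotZr mulrA -expr2 dotC.
Qed.

(** Expand [v >= 0] along [x0 + t y]. Dividing by [t] gives a nonnegative linear part for [y] and
    for [- y], hence zero; dividing by [t^2] then gives the sign of the quadratic part. *)
Lemma expansion_at_zero v x0 s (b : E) (A : 'M[R]_n) K : 0 < s ->
  v x0 = 0 -> (forall x, cball x0 s x -> 0 <= v x) ->
  (forall y, cball x0 s (x0 + y) ->
    `|v (x0 + y) - v x0 - Defs.dot b y - 2^-1 * Defs.dot (mxapp A y) y|
      <= K * `|y| ^+ 3) ->
  (forall y, 0 <= Defs.dot (mxapp A y) y) /\
  (forall y, cball x0 s (x0 + y) ->
    `|v (x0 + y) - 2^-1 * Defs.dot (mxapp A y) y| <= K * `|y| ^+ 3).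
Proof.
move=> s0 v0 vge0 vE.
have small y : exists2 t0, 0 < t0 & forall t, 0 < t -> t <= t0 ->
    t <= 1 /\ 0 <= t * Defs.dot b y + 2^-1 * (t ^+ 2 * Defs.dot (mxapp A y) y) +
      K * (t ^+ 3 * `|y| ^+ 3).
  have q0 := sqdist_ge0 x0 (x0 + y).
  have q1 : 0 < sqdist x0 (x0 + y) + 1 by rewrite ltr_wpDl.
  exists (Num.min 1 (s / (sqdist x0 (x0 + y) + 1))).
    by rewrite lt_min ltr01 divr_gt0.
  move=> t t0; rewrite le_min => /andP[t1]; rewrite ler_pdivlMr // => ts.
  split => //; have ct : cball x0 s (x0 + t *: y).
    by rewrite /cball /= sqdist_line; nra.
  have := vE _ ct; have := vge0 _ ct.
  rewrite v0 subr0 dotZr dot_mxappZ normrZ exprMn (ger0_norm (ltW t0)).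
  rewrite ler_norml; lra.
have b0 y : Defs.dot b y = 0.
  have bge y' : 0 <= Defs.dot b y'.
    have [t0 t00 tP] := small y'.
    (* Since [t <= 1], the quadratic and cubic terms together are at most [c * t^2]. *)
    pose c := `|Defs.dot (mxapp A y') y'| + `|K| * `|y'| ^+ 3.
    apply: (@ge0_of_small t0 _ c t00) => t tgt0 tt0; have [t1 tp] := tP t tgt0 tt0.
    have : 0 <= t * (Defs.dot b y' + c * t); last by rewrite pmulr_rge0.
    apply: (le_trans tp); rewrite mulrDr -addrA lerD2l /c.
    have -> : t * ((`|Defs.dot (mxapp A y') y'| + `|K| * `|y'| ^+ 3) * t) =
      t ^+ 2 * `|Defs.dot (mxapp A y') y'| + t ^+ 2 * (`|K| * `|y'| ^+ 3) by ring.
    have t20 : 0 <= t ^+ 2 by rewrite sqr_ge0.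
    apply: lerD.
      have := ler_norm (Defs.dot (mxapp A y') y').
      have := normr_ge0 (Defs.dot (mxapp A y') y'); nra.
    have -> : K * (t ^+ 3 * `|y'| ^+ 3) = t ^+ 2 * (t * K * `|y'| ^+ 3) by ring.
    rewrite ler_wpM2l // ler_wpM2r ?exprn_ge0 //.
    have := ler_norm K; have := normr_ge0 K; nra.
  apply/eqP; rewrite eq_le bge andbT -oppr_ge0 -dotNr; exact: bge.
split=> y; last first.
  by move=> ys; have := vE y ys; rewrite v0 b0 !subr0.
have [t0 t00 tP] := small y.
apply: (@ge0_of_small t0 _ (2 * (K * `|y| ^+ 3)) t00) => t tgt0 tt0.
have [_] := tP t tgt0 tt0; rewrite b0 mulr0 add0r => tp.
have : 0 <= t ^+ 2 * (Defs.dot (mxapp A y) y + 2 * (K * `|y| ^+ 3) * t).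
  have -> : t ^+ 2 * (Defs.dot (mxapp A y) y + 2 * (K * `|y| ^+ 3) * t) =
    2 * (2^-1 * (t ^+ 2 * Defs.dot (mxapp A y) y) + K * (t ^+ 3 * `|y| ^+ 3)).
    by field.
  by rewrite mulr_ge0.
by rewrite pmulr_rge0 // exprn_gt0.
Qed.

(** Rescaling preserves the quadratic part and turns the cubic remainder into [K t |y|^3], which is
    uniformly small on bounded sets. *)
Lemma blow_up_cvg v x0 s (A : 'M[R]_n) K : 0 < s ->
  (forall y, cball x0 s (x0 + y) ->
    `|v (x0 + y) - 2^-1 * Defs.dot (mxapp A y) y| <= K * `|y| ^+ 3) ->
  {family compact, (fun k x => v (x0 + k.+1%:R^-1 *: x) / k.+1%:R^-1 ^+ 2) @ \oo -->
     (fun x : E => 2^-1 * Defs.dot (mxapp A x) x)}.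
Proof.
move=> s0 vE; apply/fam_cvgP => C cC W /uniform_nbhs[G [entG GW]].
apply: filterS GW _.
move: entG; rewrite -entourage_ballE => -[e /= e0 eG].
have [B B0 BP] : exists2 B, 0 <= B & forall x, C x -> `|sqdist 0 x| <= B.
  apply: bounded_on_compact => // x _; exact/ispoly_continuous/ispoly_sqdist.
have [M M0 MP] : exists2 M, 0 <= M & forall x, C x -> `| `|x| | <= M.
  by apply: bounded_on_compact => // x _; exact: norm_continuous.
pose L := `|K| * M ^+ 3; have L0 : 0 <= L by rewrite mulr_ge0 ?exprn_ge0.
have near_small c : 0 < c -> \forall k \near \oo, (k.+1%:R^-1 : R) < c.
  move=> c0; exact: (near_infty_natSinv_lt (PosNum c0)).
(* Below this threshold [x0 + t y] stays in the ball, since [t^2 B <= t B < s]; below the next one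
   the rescaled remainder is less than [e]. *)
have c1 : 0 < Num.min 1 (s / (B + 1)).
  by rewrite lt_min ltr01 divr_gt0 // ltr_wpDl.
have c2 : 0 < e / (L + 1) by rewrite divr_gt0 // ltr_wpDl.
apply: filterS2 (near_small _ c1) (near_small _ c2) => k.
set t : R := k.+1%:R^-1; have t0 : 0 < t by rewrite invr_gt0 ltr0n.
rewrite lt_min ltr_pdivlMr ?ltr_wpDl // => /andP[t1 ts].
rewrite ltr_pdivlMr ?ltr_wpDl // => te y Cy; apply: eG; rewrite -ball_normE /=.
have yB : sqdist x0 (x0 + y) <= B.
  have -> : sqdist x0 (x0 + y) = sqdist 0 y.
    by rewrite /sqdist subr0 addrC addKr.
  exact: le_trans (ler_norm _) (BP y Cy).
have yM : `|y| <= M by have := MP y Cy; rewrite normr_id.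
have ct : cball x0 s (x0 + t *: y).
  rewrite /cball /= sqdist_line; have := sqdist_ge0 x0 (x0 + y); nra.
have := vE _ ct; rewrite dot_mxappZ normrZ exprMn (ger0_norm (ltW t0)) => H.
have t20 : 0 < t ^+ 2 by rewrite exprn_gt0.
have -> : 2^-1 * Defs.dot (mxapp A y) y - v (x0 + t *: y) / t ^+ 2 =
    - ((v (x0 + t *: y) - 2^-1 * (t ^+ 2 * Defs.dot (mxapp A y) y)) / t ^+ 2).
  by field; rewrite gt_eqF.
rewrite normrN normrM [`|_^-1|]ger0_norm ?invr_ge0 ?ltW // ltr_pdivrMr //.
apply: (le_lt_trans H).
have -> : K * (t ^+ 3 * `|y| ^+ 3) = t * (K * `|y| ^+ 3) * t ^+ 2 by ring.
rewrite ltr_pM2r //; apply: le_lt_trans te.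
apply: ler_wpM2l; first exact: ltW.
apply: (@le_trans _ _ L); last by rewrite lerDl.
rewrite /L; apply: (@le_trans _ _ (`|K| * `|y| ^+ 3)).
  by rewrite ler_wpM2r ?exprn_ge0 // ler_norm.
by rewrite ler_wpM2l // lerXn2r ?nnegrE.
Qed.

End SingularPoints.

(** * The free boundaries of [u] and [v] *)

Section FreeBoundary.
Variables (R : realType) (n : nat).
Notation E := 'rV[R]_n.
Implicit Types (u v w : E -> R) (x y : E).

Lemma inf_laplacian_cst (c : R) x : inf_laplacian (fun=> c) x = 0.
Proof.
have -> : inf_laplacian (fun=> c) x =
    Defs.dot (mxapp (hess (fun=> c) x) (grad (fun=> c) x)) 0.
  by congr Defs.dot; apply/rowP => i; rewrite !mxE derive_cst.
by rewrite /Defs.dot big1 // => i _; rewrite [X in _ * X]mxE mulr0.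
Qed.

Lemma not_closureP (A : set E) x : ~ closure A x ->
  exists2 B, nbhs x B & forall y, B y -> ~ A y.
Proof.
move=> /existsNP[B /not_implyP[xB AB]]; exists B => // y By Ay.
by apply: AB; exists y.
Qed.

Lemma visc_le_continuous (H : (E -> R) -> E -> R) h w :
  visc_le H (@unit_ball R n) h w ->
  forall x, unit_ball x -> {for x, continuous w}.
Proof.
move=> [cw _] x Bx; have := cw; rewrite (continuous_open_subspace _ (@open_unit_ball R n)).
by apply; rewrite inE.
Qed.

(** A neighbourhood of [x] on which [u] vanished would contain a point of [{v > 0}]; there the
    constant 0 touches [u] from above although its infinity Laplacian is 0, not at least 1. *)
Lemma closure_pos_set u v : (forall x, unit_ball x -> 0 <= u x) ->
  visc_eq (@inf_laplacian R n) (pos_set v) (cst 1) u ->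
  closure (pos_set v) `&` @unit_ball R n `<=` closure (pos_set u).
Proof.
move=> u0 [_ [_ uge]] x [xv Bx]; apply: contrapT => /not_closureP[B xB uB].
have [y [vy By]] := xv _ (nbhs_interior xB).
have uz z : unit_ball z -> B z -> u z = 0.
  move=> Bz zB; apply/eqP; rewrite eq_le u0 // andbT leNgt.
  by apply/negP => uz; apply: (uB z zB).
have ny : nbhs y (@unit_ball R n).
  by apply: open_nbhs_nbhs; split; [exact: open_unit_ball|case: vy].
have touch : touches_above (fun=> 0) u y.
  split; first by rewrite (uz y) //; [case: vy|exact: nbhs_singleton By].
  by apply: filterS2 By ny => z zB Bz; rewrite uz.
have := uge _ y (ispoly_C2 _ (ispoly_cst n 0)) vy touch.
by rewrite inf_laplacian_cst /= ler10.
Qed.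

Lemma rel_boundary_zero v x : (forall y, unit_ball y -> 0 <= v y) ->
  {for x, continuous v} -> rel_boundary (pos_set v) x -> v x = 0.
Proof.
move=> v0 cv [Bx [_ xc]]; apply/eqP; rewrite eq_le v0 // andbT leNgt.
apply/negP => vx; have [y [[By npos] vy]] := xc _ (cvgr_gt _ cv _ vx).
by apply: npos.
Qed.

End FreeBoundary.

Theorem theorem6p3 (R : realType) (n : nat) (u v : 'rV[R]_n -> R)
    (hu : forall x, unit_ball x -> 0 <= u x)
    (hv : forall x, unit_ball x -> 0 <= v x)
    (huv : visc_solution u v) :
  rel_boundary (pos_set v) `\` rel_boundary (pos_set u)
    `<=` [set x0 | singular_point v x0].
Proof.
have [_ visc_v visc_u visc_vu] := huv.
move=> x0 [vx0 nux0]; have [Bx0 [x0v x0cv]] := vx0.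
(* In dimension 0 the space is one point, which cannot lie both in [pos_set v] and in its
   complement, so the relative boundary is empty. *)
have [n0|n0] := posnP n.
  have [y [[_ vy] _]] := x0v _ filterT; have [z [[Bz vz] _]] := x0cv _ filterT.
  have yz : y = z by apply/rowP => i; have := ltn_ord i; rewrite [X in (_ < X)%N]n0.
  by case: vz; split => //=; rewrite -yz.
have x0u : closure (pos_set u) x0 by apply: (closure_pos_set hu visc_u); split.
have x0B : nbhs x0 (@unit_ball R n).
  by apply: open_nbhs_nbhs; split => //; exact: open_unit_ball.
(* Being in the closure of [pos_set u] but off its relative boundary, [x0] is not in the closure of
   the complement, so [u > 0] near [x0]. *)
have [B x0n uB] : exists2 B, nbhs x0 B &
    forall y, B y -> ~ (@unit_ball R n `\` pos_set u) y.
  by apply: not_closureP => x0cu; apply: nux0.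
have x0pu : nbhs x0 (pos_set u).
  apply: filterS2 x0n x0B => y yB By; apply: contrapT => npos.
  by apply: (uB y yB).
have [r r0 rU] := nbhs_cube x0pu.
have cv := visc_le_continuous visc_v.
have cvu x : pos_set u x -> {for x, continuous v} by case=> Bx _; exact: cv.
have [P [pP lP Pv]] := visc_laplacian_approximation n0 r0 rU cvu visc_vu.
have s0 : 0 < r ^+ 2 by rewrite exprn_gt0.
have s640 : 0 < r ^+ 2 / 64 by rewrite divr_gt0.
have [b [A [K [AT trA vE]]]] := second_order_expansion n0 s0 pP lP Pv.
have vge0 x : cball x0 (r ^+ 2 / 64) x -> 0 <= v x.
  move=> xs; have : cball x0 (r ^+ 2) x by apply: (le_trans xs); lra.
  by move=> /(cball_cube r0)/rU[Bx _]; exact: hv.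
have vx00 := rel_boundary_zero hv (cv x0 Bx0) vx0.
have [A0 vE'] := expansion_at_zero s640 vx00 vge0 vE.
split => //; exists A, (fun k => k.+1%:R^-1); split => //.
(* The filter [0^'+] only constrains positive values, and every term of the sequence is positive. *)
- move=> W W0; have H : \forall k \near \oo, 0 < k.+1%:R^-1 :> R -> W k.+1%:R^-1.
    exact: (@cvg_harmonic R _ W0).
  suff : \forall k \near \oo, W k.+1%:R^-1 by [].
  by apply: filterS H => k; apply; rewrite invr_gt0 ltr0n.
- exact: (@blow_up_cvg R n v x0 _ A K s640 vE').
Qed.
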